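(* Let $M$ be a smooth oriented surface in $E^3$ without umbilic points and without critical points of its mean curvature $H$, with all notation as in the context, and assume $d\alpha_1=0$, $d\alpha_2=\alpha_1\wedge\alpha_2$ and $d\vartheta_1=0$. Then the differential system generated in terms of the differentials of the variables $\psi$, $A$, $B$ and $C$ is closed. The variables $H,J,A,B,C$ remain constant along the $\vartheta_2$-curves, that is, along the curves on which $\vartheta_1=0$. Hence an isometry that preserves $H$ must map the $\vartheta_1$-, $\vartheta_2$-curves of $M$ onto the corresponding $\vartheta_1^*$-, $\vartheta_2^*$-curves of the associated surface $M^*$ which is isometric to $M$.
   Context: The surface $M$ carries an orthonormal frame $e_1,e_2,e_3$ with $e_3$ the unit normal and $e_1,e_2$ along principal directions; $\omega_1,\omega_2$ is the coframe dual to $e_1,e_2$, and $\omega_{12}=h\omega_1+k\omega_2$ is its connection form, i.e. the unique one-form with $d\omega_1=\omega_{12}\wedge\omega_2$, $d\omega_2=\omega_1\wedge\omega_{12}$. The principal curvatures are $a>c$, and $H=\frac12(a+c)$, $J=\frac12(a-c)>0$. By the Codazzi equations there are functions $u,v$ with $\frac{1}{a-c}da-h\omega_2=(u-k)\omega_1$ and $\frac1{a-c}dc-k\omega_1=(v-h)\omega_2$. Set $A=\sqrt{u^2+v^2}>0$ and let $\psi$ be the (locally defined) angle with $u=A\cos\psi$, $v=A\sin\psi$. Define $\vartheta_1=u\omega_1+v\omega_2$, $\vartheta_2=-v\omega_1+u\omega_2$, $\alpha_1=u\omega_1-v\omega_2$, $\alpha_2=v\omega_1+u\omega_2$; one has $dH=J\vartheta_1$.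 Under the assumptions of the claim there is a function $B$ with $d\log A=B\vartheta_1$ and, writing $d\psi=\psi_1\alpha_1+\psi_2\alpha_2$, a function $C$ with $2\psi_1=C\sin(2\psi)$ and $2\psi_2+1=-C\cos(2\psi)$; these define $B$ and $C$. The $\vartheta_1$-curves are the integral curves of $\vartheta_2=0$ and the $\vartheta_2$-curves the integral curves of $\vartheta_1=0$. Starred objects are the same objects for $M^*$. ''Closed'' means that the process of introducing new variables terminates: the differentials of all these functions can be computed without the need to introduce more functions. *)

(* Defs.v *)
From HB Require Import structures.
From mathcomp Require Import all_boot all_order all_algebra.
From mathcomp Require Import all_classical all_reals all_analysis.

Set Implicit Arguments.
Unset Strict Implicit.
Unset Printing Implicit Defensive.

Import Order.TTheory GRing.Theory Num.Theory.
Import numFieldNormedType.Exports.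

Local Open Scope classical_set_scope.
Local Open Scope ring_scope.

(* C^k and C^oo maps on an open set U of a normed space. *)
Fixpoint Ck (R : realType) (V W : normedModType R) (k : nat)
    (U : set V) (f : V -> W) : Prop :=
  match k with
  | 0 => forall y, U y -> {for y, continuous f}
  | k'.+1 => (forall y, U y -> differentiable f y) /\
             (forall v : V, Ck k' U (fun y => 'D_v f y))
  end.

Definition smooth (R : realType) (V W : normedModType R)
    (U : set V) (f : V -> W) : Prop := forall k, Ck k U f.

(* The Euclidean inner product; the library norm on 'rV is the sup norm and
   is used here only for its topology. *)
Definition dot (R : realType) (n : nat) (v w : 'rV[R]_n) : R :=
  \sum_(i < n) v 0 i * w 0 i.

(* [chart x U phi]: phi is a homeomorphism of the open set U of R^2 onto an
   open set of T, and x \o phi is a smooth immersion.  Two such phi with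
   overlapping images differ by a diffeomorphism, because x \o phi is locally
   an embedding; so the smooth structure that makes x an immersion is the one
   whose local parametrizations are these phi. *)
Definition chart (R : realType) (T : topologicalType) (x : T -> 'rV[R]_3)
    (U : set 'rV[R]_2) (phi : 'rV[R]_2 -> T) : Prop :=
  [/\ open U,
      {in U &, injective phi},
      (forall y, U y -> {for y, continuous phi}),
      (forall V, V `<=` U -> open V -> open (phi @` V)) &
      smooth U (x \o phi) /\
      (forall y, U y -> forall xi, 'D_xi (x \o phi) y = 0 -> xi = 0)].

(* A smooth (immersed) surface in E^3: a topological surface with its position
   map [pos] into R^3. *)
Record surface (R : realType) := Surface {
  carrier :> topologicalType;
  pos : carrier -> 'rV[R]_3;
  surface_hausdorff : hausdorff_space carrier;
  surface_second_countable : @second_countable carrier;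
  surface_charts : forall p : carrier,
    exists U phi, chart pos U phi /\ (phi @` U) p
}.

(* Tangent vectors of M are represented by their images in R^3, so the tangent
   plane at phi y consists of the vectors 'D_xi (pos \o phi) y.  Forms take
   arbitrary vectors of R^3, but only their values on tangent vectors are ever
   used. *)
Definition form1 (R : realType) (M : surface R) := M -> 'rV[R]_3 -> R.
Definition form2 (R : realType) (M : surface R) :=
  M -> 'rV[R]_3 -> 'rV[R]_3 -> R.

Definition wedge (R : realType) (M : surface R) (a b : form1 M) : form2 M :=
  fun p v w => a p v * b p w - a p w * b p v.

Definition smooth_on (R : realType) (M : surface R) (V : normedModType R)
    (W : set M) (g : M -> V) : Prop :=
  forall U phi, chart (@pos R M) U phi ->
    smooth (U `&` phi @^-1` W) (g \o phi).

(* [has_diff W g L]: dg = L on the open set W. *)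
Definition has_diff (R : realType) (M : surface R) (V : normedModType R)
    (W : set M) (g : M -> V) (L : M -> 'rV[R]_3 -> V) : Prop :=
  forall U phi, chart (@pos R M) U phi ->
  forall y, U y -> W (phi y) ->
    differentiable (g \o phi) y /\
    forall xi : 'rV[R]_2,
      'D_xi (g \o phi) y = L (phi y) ('D_xi (@pos R M \o phi) y).

Definition critical_point (R : realType) (M : surface R)
    (g : M -> R) (p : M) : Prop :=
  forall U phi, chart (@pos R M) U phi ->
  forall y, U y -> phi y = p -> forall xi : 'rV[R]_2, 'D_xi (g \o phi) y = 0.

(* The coordinate vector fields of a parametrization, as vectors of R^3. *)
Definition coordv (R : realType) (M : surface R) (phi : 'rV[R]_2 -> M)
    (i : 'I_2) (y : 'rV[R]_2) : 'rV[R]_3 :=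
  'D_(delta_mx 0 i) (@pos R M \o phi) y.

(* [has_extd w eta]: dw = eta, by the coordinate formula
   (dw)(d_0, d_1) = d_0 (w d_1) - d_1 (w d_0). *)
Definition has_extd (R : realType) (M : surface R)
    (w : form1 M) (eta : form2 M) : Prop :=
  forall U phi, chart (@pos R M) U phi ->
  let comp (i : 'I_2) (z : 'rV[R]_2) : R := w (phi z) (coordv phi i z) in
  forall y, U y ->
    [/\ differentiable (comp 0) y,
        differentiable (comp 1) y &
        'D_(delta_mx 0 0) (comp 1) y - 'D_(delta_mx 0 1) (comp 0) y =
        eta (phi y) (coordv phi 0 y) (coordv phi 1 y)].

(* [principal N E kappa]: the shape operator -dN maps E to kappa E. *)
Definition principal (R : realType) (M : surface R)
    (N E : M -> 'rV[R]_3) (kappa : M -> R) : Prop :=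
  forall U phi, chart (@pos R M) U phi ->
  forall y, U y -> forall xi : 'rV[R]_2,
    'D_xi (@pos R M \o phi) y = E (phi y) ->
    - 'D_xi (N \o phi) y = kappa (phi y) *: E (phi y).

(* An oriented surface without umbilics and without critical points of the
   mean curvature, with its principal frame and the associated functions.
   The unit normal field [e3] orients M.  The coframe dual to the orthonormal
   fields e1, e2 is dot e1, dot e2. *)
Record framed_surface (R : realType) := FramedSurface {
  surf :> surface R;
  e1 : surf -> 'rV[R]_3;
  e2 : surf -> 'rV[R]_3;
  e3 : surf -> 'rV[R]_3;
  ka : surf -> R;
  kc : surf -> R;
  hh : surf -> R;
  kk : surf -> R;
  uu : surf -> R;
  vv : surf -> R;
  e_smooth : [/\ smooth_on setT e1, smooth_on setT e2 & smooth_on setT e3];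
  coef_smooth : [/\ smooth_on setT (ka : _ -> R^o),
                    smooth_on setT (kc : _ -> R^o) &
                [/\ smooth_on setT (hh : _ -> R^o),
                    smooth_on setT (kk : _ -> R^o),
                    smooth_on setT (uu : _ -> R^o) &
                    smooth_on setT (vv : _ -> R^o)]];
  e_unit : forall p,
    [/\ dot (e1 p) (e1 p) = 1, dot (e2 p) (e2 p) = 1 & dot (e3 p) (e3 p) = 1];
  e_ortho : forall p,
    [/\ dot (e1 p) (e2 p) = 0, dot (e1 p) (e3 p) = 0 & dot (e2 p) (e3 p) = 0];
  e3_normal : forall U phi, chart (@pos R surf) U phi ->
    forall y, U y -> forall xi : 'rV[R]_2,
      dot (e3 (phi y)) ('D_xi (@pos R surf \o phi) y) = 0;
  e1_principal : principal e3 e1 ka;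
  e2_principal : principal e3 e2 kc;
  no_umbilic : forall p, kc p < ka p;
  no_critical : forall p,
    ~ critical_point (fun q => (ka q + kc q) / 2) p;
  (* d omega1 = omega12 /\ omega2 and d omega2 = omega1 /\ omega12,
     for omega12 = h omega1 + k omega2 *)
  structure_eq1 :
    let w1 : form1 surf := fun p => dot (e1 p) in
    let w2 : form1 surf := fun p => dot (e2 p) in
    let w12 : form1 surf := fun p v => hh p * w1 p v + kk p * w2 p v in
    has_extd w1 (wedge w12 w2);
  structure_eq2 :
    let w1 : form1 surf := fun p => dot (e1 p) in
    let w2 : form1 surf := fun p => dot (e2 p) in
    let w12 : form1 surf := fun p v => hh p * w1 p v + kk p * w2 p v in
    has_extd w2 (wedge w1 w12);
  (* da / (a - c) - h omega2 = (u - k) omega1 and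
     dc / (a - c) - k omega1 = (v - h) omega2 *)
  codazzi_a : has_diff setT (ka : _ -> R^o) (fun p w =>
    (ka p - kc p) *
    ((uu p - kk p) * dot (e1 p) w + hh p * dot (e2 p) w));
  codazzi_c : has_diff setT (kc : _ -> R^o) (fun p w =>
    (ka p - kc p) *
    ((vv p - hh p) * dot (e2 p) w + kk p * dot (e1 p) w))
}.

Section Derived.
Context (R : realType) (M : framed_surface R).

Definition omega1 : form1 M := fun p => dot (e1 p).
Definition omega2 : form1 M := fun p => dot (e2 p).

Definition curvH (p : M) : R := (ka p + kc p) / 2.
Definition curvJ (p : M) : R := (ka p - kc p) / 2.
Definition ampA (p : M) : R := Num.sqrt (uu p ^+ 2 + vv p ^+ 2).

Definition theta1 : form1 M :=
  fun p w => uu p * omega1 p w + vv p * omega2 p w.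
Definition theta2 : form1 M :=
  fun p w => - vv p * omega1 p w + uu p * omega2 p w.
Definition alpha1 : form1 M :=
  fun p w => uu p * omega1 p w - vv p * omega2 p w.
Definition alpha2 : form1 M :=
  fun p w => vv p * omega1 p w + uu p * omega2 p w.

(* psi is a branch of the angle on the open set W *)
Definition local_angle (W : set M) (psi : M -> R) : Prop :=
  [/\ open W, smooth_on W (psi : _ -> R^o) &
      forall p, W p -> uu p = ampA p * cos (psi p) /\
                       vv p = ampA p * sin (psi p)].

Definition is_B (B : M -> R) : Prop :=
  smooth_on setT (B : _ -> R^o) /\
  has_diff setT ((fun p => ln (ampA p)) : _ -> R^o)
    (fun p w => B p * theta1 p w).

(* C does not depend on the branch psi of the angle. *)
Definition is_C (C : M -> R) : Prop :=
  smooth_on setT (C : _ -> R^o) /\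
  forall (W : set M) (psi psi1 psi2 : M -> R), local_angle W psi ->
    has_diff W (psi : _ -> R^o)
      (fun p w => psi1 p * alpha1 p w + psi2 p * alpha2 p w) ->
    forall p, W p ->
      2 * psi1 p = C p * sin (2 * psi p) /\
      2 * psi2 p + 1 = - C p * cos (2 * psi p).

(* The variables of the differential system: psi, A, B, C, and the functions
   H, J already present. *)
Definition state (psi B C : M -> R) (p : M) : 'rV[R]_6 :=
  \row_(i < 6) [:: psi p; ampA p; B p; C p; curvH p; curvJ p]`_i.

End Derived.

(* The states with A > 0 and J > 0. *)
Definition admissible (R : realType) : set 'rV[R]_6 :=
  [set s | 0 < s 0 (inord 1) /\ 0 < s 0 (inord 5)].

Definition smooth_curve (R : realType) (M : surface R)
    (I : set R) (g : R -> M) : Prop :=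
  forall t, I t -> exists U phi (V : set R^o) (b : R^o -> 'rV[R]_2),
    [/\ chart (@pos R M) U phi, open V, V t, smooth V b &
        forall s, V s -> U (b s) /\ g s = phi (b s)].

Definition velocity (R : realType) (M : surface R) (g : R -> M) (t : R) :
    'rV[R]_3 := 'D_1 (@pos R M \o g : R^o -> 'rV[R]_3) t.

(* A regular curve on the open interval I along which the form w vanishes. *)
Definition integral_curve (R : realType) (M : surface R) (w : form1 M)
    (I : set R) (g : R -> M) : Prop :=
  [/\ open I, is_interval I, smooth_curve I g &
      forall t, I t -> velocity g t <> 0 /\ w (g t) (velocity g t) = 0].

Definition theta1_curve (R : realType) (M : framed_surface R) :=
  integral_curve (@theta2 R M).
Definition theta2_curve (R : realType) (M : framed_surface R) :=
  integral_curve (@theta1 R M).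

Definition constant_along (R : realType) (M : surface R)
    (I : set R) (g : R -> M) (f : M -> R) : Prop :=
  forall s t, I s -> I t -> f (g s) = f (g t).

(* A bijection carrying local parametrizations to local parametrizations (that
   is, a diffeomorphism) with the same first fundamental forms. *)
Definition is_isometry (R : realType) (M N : surface R) (f : M -> N) : Prop :=
  bijective f /\
  forall U phi, chart (@pos R M) U phi ->
    chart (@pos R N) U (f \o phi) /\
    forall y, U y -> forall xi eta : 'rV[R]_2,
      dot ('D_xi (@pos R N \o (f \o phi)) y)
          ('D_eta (@pos R N \o (f \o phi)) y) =
      dot ('D_xi (@pos R M \o phi) y) ('D_eta (@pos R M \o phi) y).

(* f maps the integral curves of w = 0 onto those of w' = 0. *)
Definition maps_curves_onto (R : realType) (M N : surface R) (f : M -> N)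
    (w : form1 M) (w' : form1 N) : Prop :=
  (forall I g, integral_curve w I g -> integral_curve w' I (f \o g)) /\
  (forall I g', integral_curve w' I g' ->
     exists2 g, integral_curve w I g & forall t, I t -> g' t = f (g t)).

(* Main.v *)
(* Write alpha12 for the connection form of the metric alpha1^2 + alpha2^2. The
   hypotheses on dalpha1 and dalpha2 say that alpha12 = alpha2, and this metric is
   conformal to the one of M with factor A^2; since dlog A = B theta1, it follows
   that omega12 = dpsi + alpha2 - B theta2. Inserting the definition of C gives
   h = v (1/2 + B + C/2) and k = u (1/2 - B - C/2), hence
   dpsi = -(alpha2 + C theta2)/2 and, with the Codazzi equations,
   dlog J = (2 B + C) theta1. As theta1 is closed, ddlog A = ddlog J = 0 make dB
   and dC multiples of theta1; the factors C^2 - 1 and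
   1 + B C + (H^2 - J^2)/A^2 come from ddpsi = 0 and from the Gauss equation.
   Since dH = J theta1 on both surfaces, an isometry preserving H pulls theta1*
   back to a positive multiple of theta1, hence preserves the kernel of theta1
   and its orthogonal complement, the kernel of theta2. *)
From HB Require Import structures.
Require Import Defs.
From mathcomp Require Import all_boot all_order all_algebra.
From mathcomp Require Import all_classical all_reals all_analysis.
From mathcomp Require Import ring lra.
Import Order.TTheory GRing.Theory Num.Theory.
Import numFieldNormedType.Exports.
Set Implicit Arguments.
Unset Strict Implicit.
Unset Printing Implicit Defensive.
Local Open Scope classical_set_scope.
Local Open Scope ring_scope.

(** * Smooth functions *)

Section Calculus.
Context {R : realType} {V : normedModType R}.

(** Closedness is the existence of two fixed maps of the six variables, chosen before the surface,
    so every differential has to be found explicitly. Both quadratic factors rest on dtheta2 = -C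
    theta1 /\ theta2, which follows from omega12 + dpsi = -(B + C) theta2. With alpha1 /\ alpha2 =
    theta1 /\ theta2 one has 2 ddpsi = -(theta1 /\ theta2 + dC /\ theta2 + C dtheta2) and domega12 =
    theta1 /\ theta2 - dB /\ theta2 - B dtheta2, to be compared with 0 and with -ac omega1 /\
    omega2, where ac = H^2 - J^2. Forms are evaluated on the two coordinate directions of a chart,
    and Cramer's rule replaces exterior algebra. The angle exists only locally: a branch is chosen
    near each point and eliminated from the formulas for B and C. A curve is smooth through some
    chart, possibly different at each point and unrelated to those an isometry provides. Mapping
    curves onto curves therefore needs a change of chart, whose smoothness is derived from the
    immersion. *)

Lemma near_eq_differentiable (W : normedModType R) (f g : V -> W) (x : V) :
  (\near x, f x = g x) -> differentiable f x -> differentiable g x.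
Proof.
move=> fg df.
have gE : g \o shift x = cst (g x) + 'd f x +o_ 0 id.
  apply/eqaddoP => _ /posnumP[e].
  have /eqaddoP/(_ e%:num (gt0 e)) H := diff_locally df.
  have fg0 : \forall h \near 0, f (h + x) = g (h + x).
    by move: fg; rewrite (near_shift 0) subr0.
  near=> h; have : `|(f \o shift x - (cst (f x) + 'd f x)) h| <= e%:num * `|h|.
    by near: h; exact: H.
  by rewrite !fctE /= (nbhs_singleton fg) (near fg0).
apply/diff_locallyP.
have dE := diff_unique (diff_continuous df) gE.
by rewrite dE; split => //; exact: diff_continuous.
Unshelve. all: by end_near. Qed.

Lemma derive_scalar_comp (phi : R -> R) (a : R) (f : V -> R) (y : V) :
  is_derive (f y) 1 phi a -> differentiable f y ->
  differentiable (fun z => phi (f z)) y /\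
  forall v, 'D_v (fun z => phi (f z)) y = a * 'D_v f y.
Proof.
move=> [pd <-] df; have /derivable1_diffP dp := pd.
have dc : differentiable (phi \o f) y by exact: differentiable_comp.
split=> // v.
rewrite (deriveE v dc) diff_comp //= diff1E // derive1E deriveE //=.
by rewrite mulrC [in RHS]deriveE.
Qed.

End Calculus.

Section CkTheory.
Context {R : realType} {V : normedModType R}.
Implicit Types (W : normedModType R) (U : set V).

Lemma CkS W k U (f : V -> W) : Ck k.+1 U f <->
  (forall y, U y -> differentiable f y) /\ (forall v, Ck k U (fun y => 'D_v f y)).
Proof. by []. Qed.

Lemma Ck_ext W k U (f g : V -> W) : open U -> (forall y, U y -> f y = g y) ->
  Ck k U f -> Ck k U g.
Proof.
move=> oU; elim: k f g => [|k IH] f g fg /=.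
  move=> cf y Uy; have := cf y Uy; rewrite /prop_for /continuous_at -(fg y Uy).
  apply: cvg_trans; apply: near_eq_cvg; near=> z; apply: fg; near: z.
  exact: open_nbhs_nbhs.
have ng y : U y -> \near y, f y = g y.
  by move=> Uy; near=> z; apply: fg; near: z; exact: open_nbhs_nbhs.
move=> [df Df]; split=> [y Uy|v].
  by apply: near_eq_differentiable (df y Uy); exact: ng.
apply: IH (Df v) => y Uy; exact/near_eq_derive/ng.
Unshelve. all: by end_near. Qed.

Lemma Ck_sub W k U U' (f : V -> W) : U' `<=` U -> Ck k U f -> Ck k U' f.
Proof.
move=> sU; elim: k f => [|k IH] f /=; first by move=> H y /sU; exact: H.
by move=> [df Df]; split=> [y /sU|v]; [exact: df|exact: IH].
Qed.

Lemma smooth_sub W U U' (f : V -> W) : U' `<=` U -> smooth U f -> smooth U' f.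
Proof. by move=> sU sf k; apply: Ck_sub (sf k). Qed.

Lemma Ck_pred W k U (f : V -> W) : Ck k.+1 U f -> Ck k U f.
Proof.
elim: k f => [|k IH] f; first by move=> [df _] y Uy; exact/differentiable_continuous/df.
by move=> [df Df]; split=> // v; exact: IH.
Qed.

Lemma smooth_differentiable W U (f : V -> W) y :
  smooth U f -> U y -> differentiable f y.
Proof. by move=> /(_ 1%N)[df _]; exact: df. Qed.

Lemma smooth_continuous W U (f : V -> W) y :
  smooth U f -> U y -> {for y, continuous f}.
Proof. by move=> /(_ 0%N) cf; exact: cf. Qed.

Lemma smooth_derive W U (f : V -> W) v : smooth U f -> smooth U (fun y => 'D_v f y).
Proof. by move=> sf k; have [_] := sf k.+1; exact. Qed.

Lemma Ck_cst W k U (w : W) : Ck k U (fun=> w).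
Proof.
elim: k w => [|k IH] w /=; first by move=> y _; exact: cvg_cst.
split=> [y _|v]; first exact: differentiable_cst.
have -> : (fun y : V => 'D_v (fun=> w) y) = (fun=> 0).
  by apply/funext => y; exact: derive_cst.
exact: IH.
Qed.

Lemma CkD W k U (f g : V -> W) : open U ->
  Ck k U f -> Ck k U g -> Ck k U (fun y => f y + g y).
Proof.
move=> oU; elim: k f g => [|k IH] f g /=.
  by move=> cf cg y Uy; apply: (@continuousD _ _ _ f g); [exact: cf|exact: cg].
move=> [df Df] [dg Dg]; split=> [y Uy|v].
  by apply: (@differentiableD _ _ _ f g); [exact: df|exact: dg].
apply: (@Ck_ext _ _ _ (fun y => 'D_v f y + 'D_v g y)) => // [y Uy|].
  by rewrite (@deriveD _ _ _ f g) //; apply: diff_derivable; [exact: df|exact: dg].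
exact: IH.
Qed.

Lemma CkM k U (f g : V -> R) : open U ->
  Ck k U f -> Ck k U g -> Ck k U (fun y => f y * g y).
Proof.
move=> oU; elim: k f g => [|k IH] f g.
  by move=> cf cg y Uy; apply: (@continuousM _ _ f g); [exact: cf|exact: cg].
move=> Cf Cg; have /CkS[df Df] := Cf; have /CkS[dg Dg] := Cg; apply/CkS; split=> [y Uy|v].
  by apply: (@differentiableM _ _ f g); [exact: df|exact: dg].
apply: (@Ck_ext _ _ _ (fun y => f y * 'D_v g y + g y * 'D_v f y)) => // [y Uy|].
  by rewrite (@deriveM _ _ f g) //; apply: diff_derivable; [exact: df|exact: dg].
by apply: CkD => //; apply: IH => //; [exact: (Ck_pred Cf)|exact: (Ck_pred Cg)].
Qed.

Lemma Ck_scale W k U (f : V -> R) (w : W) : open U ->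
  Ck k U f -> Ck k U (fun y => f y *: w).
Proof.
move=> oU; elim: k f => [|k IH] f.
  move=> cf y Uy; apply: (@continuousZr_tmp _ _ _ f w); exact: cf.
move=> /CkS[df Df]; apply/CkS; split=> [y Uy|v].
  apply: (@differentiableZl _ _ _ f w); exact: df.
apply: (@Ck_ext _ _ _ (fun y => 'D_v f y *: w)) => // [y Uy|].
  have dfy := df y Uy.
  rewrite [RHS](@deriveE _ _ _ (fun y => f y *: w)); last exact: differentiableZl.
  by rewrite diffZl // deriveE.
by apply: IH; exact: Df.
Qed.

Lemma Ck_lin W k U (l : {linear V -> W}) : continuous l -> Ck k U l.
Proof.
case: k => [|k] cl /=; first by move=> y _; exact: cl.
split=> [y _|v]; first exact: linear_differentiable.
have -> : (fun y : V => 'D_v l y) = (fun=> l v).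
  apply/funext => y; rewrite deriveE; last exact: linear_differentiable.
  by rewrite diff_lin.
exact: Ck_cst.
Qed.

(** Only k derivatives of [dphi \o f] are asked for, so when [dphi] is built from [phi] itself or
    from functions already treated, each step gains one order: this yields the inverse, sine, cosine
    and arctangent. *)
Lemma Ck_chain k U (phi dphi : R -> R) (f : V -> R) : open U ->
  (forall y, U y -> is_derive (f y) 1 phi (dphi (f y))) ->
  Ck k.+1 U f -> Ck k U (fun y => dphi (f y)) -> Ck k.+1 U (fun y => phi (f y)).
Proof.
move=> oU dp /CkS[df Df] Cd; apply/CkS; split=> [y Uy|v].
  by have [] := derive_scalar_comp (dp y Uy) (df y Uy).
apply: (@Ck_ext _ _ _ (fun y => dphi (f y) * 'D_v f y)) => // [y Uy|].
  by have [_ ->] := derive_scalar_comp (dp y Uy) (df y Uy).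
exact: CkM.
Qed.

Lemma CkV k U (f : V -> R) : open U -> (forall y, U y -> f y != 0) ->
  Ck k U f -> Ck k U (fun y => (f y)^-1).
Proof.
move=> oU f0; elim: k => [|k IH] Cf.
  by move=> y Uy; apply: (@continuousV _ _ f); [exact: f0|exact: Cf].
have CV := IH (Ck_pred Cf).
apply: (@Ck_chain _ _ GRing.inv (fun x => - (x^-1 * x^-1))) => // [y Uy|].
  have /= := @is_deriveV _ id (f y) 1 1 (f0 y Uy) _.
  by move=> /(_ (is_derive_id _ _)) H; apply: is_derive_eq H _;
    rewrite /GRing.scale /= mulr1 expr2 invfM.
rewrite (_ : (fun y => _) = (fun y => (-1) * ((f y)^-1 * (f y)^-1))).
  by apply: CkM => //; [exact: Ck_cst|exact: CkM].
by apply/funext => y; rewrite mulN1r.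
Qed.

(** Both at once, since each is the derivative of the other up to sign. *)
Lemma Ck_sin_cos k U (f : V -> R) : open U -> Ck k U f ->
  Ck k U (fun y => sin (f y)) /\ Ck k U (fun y => cos (f y)).
Proof.
move=> oU; elim: k => [|k IH] Cf.
  split=> y Uy; apply: continuous_comp; by
    [exact: Cf|exact: continuous_sin|exact: continuous_cos].
have [Cs Cc] := IH (Ck_pred Cf); split.
  by apply: (@Ck_chain _ _ sin cos) => // y _; exact: is_derive_sin.
apply: (@Ck_chain _ _ cos (fun x => - sin x)) => //.
rewrite (_ : (fun y => _) = (fun y => (-1) * sin (f y))).
  by apply: CkM => //; exact: Ck_cst.
by apply/funext => y; rewrite mulN1r.
Qed.

Lemma Ck_atan k U (f : V -> R) : open U -> Ck k U f -> Ck k U (fun y => atan (f y)).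
Proof.
case: k => [|k] oU Cf.
  by move=> y Uy; apply: continuous_comp; [exact: Cf|exact: continuous_atan].
apply: (@Ck_chain _ _ atan (fun x => (1 + x ^+ 2)^-1)) => //.
have Cf' := Ck_pred Cf.
apply: CkV => // [y _|]; first by rewrite gt_eqF // ltr_pwDl // sqr_ge0.
by apply: CkD => //; [exact: Ck_cst|under eq_fun do rewrite expr2; exact: CkM].
Qed.

Lemma smooth_cst W U (w : W) : smooth U (fun=> w).
Proof. by move=> k; exact: Ck_cst. Qed.

Lemma smoothD W U (f g : V -> W) : open U ->
  smooth U f -> smooth U g -> smooth U (fun y => f y + g y).
Proof. by move=> oU sf sg k; exact: CkD. Qed.

Lemma smoothM U (f g : V -> R) : open U ->
  smooth U f -> smooth U g -> smooth U (fun y => f y * g y).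
Proof. by move=> oU sf sg k; exact: CkM. Qed.

Lemma smoothN U (f : V -> R) : open U -> smooth U f -> smooth U (fun y => - f y).
Proof.
by move=> oU sf; under eq_fun do rewrite -mulN1r; apply: smoothM => //; exact: smooth_cst.
Qed.

Lemma smoothV U (f : V -> R) : open U -> (forall y, U y -> f y != 0) ->
  smooth U f -> smooth U (fun y => (f y)^-1).
Proof. by move=> oU f0 sf k; exact: CkV. Qed.

Lemma smooth_sin U (f : V -> R) : open U -> smooth U f -> smooth U (fun y => sin (f y)).
Proof. by move=> oU sf k; have [] := Ck_sin_cos oU (sf k). Qed.

Lemma smooth_cos U (f : V -> R) : open U -> smooth U f -> smooth U (fun y => cos (f y)).
Proof. by move=> oU sf k; have [] := Ck_sin_cos oU (sf k). Qed.

Lemma smooth_atan U (f : V -> R) : open U -> smooth U f -> smooth U (fun y => atan (f y)).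
Proof. by move=> oU sf k; exact: Ck_atan. Qed.

Lemma Ck_sum W k U n (f : 'I_n -> V -> W) : open U ->
  (forall i, Ck k U (f i)) -> Ck k U (fun y => \sum_(i < n) f i y).
Proof.
move=> oU; elim: n f => [|n IH] f Cf.
  by under eq_fun do rewrite big_ord0; exact: Ck_cst.
by under eq_fun do rewrite big_ord_recr /=; apply: CkD => //; exact: IH.
Qed.

Lemma Ck_row k U n (f : V -> 'rV[R]_n) : open U ->
  (forall i, Ck k U (fun y => f y 0 i)) -> Ck k U f.
Proof.
move=> oU Cf; rewrite (_ : f = fun y => \sum_(j < n) f y 0 j *: delta_mx 0 j); last first.
  by apply/funext => y; exact: row_sum_delta.
by apply: Ck_sum => // i; exact: Ck_scale.
Qed.

Lemma derivable_row n (f : V -> 'rV[R]_n) y v :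
  differentiable f y -> forall i, 'D_v (fun z => f z 0 i) y = ('D_v f y) 0 i.
Proof. by move=> df i; rewrite derive_mx ?mxE //; exact: diff_derivable. Qed.

Lemma differentiable_entry n (f : V -> 'rV[R]_n) y i :
  differentiable f y -> differentiable (fun z => f z 0 i) y.
Proof.
move=> df; apply: (@differentiable_comp _ _ _ _ f (fun N : 'rV[R]_n => N 0 i)) => //.
exact: differentiable_coord.
Qed.

Lemma Ck_entry k U n (f : V -> 'rV[R]_n) i : open U ->
  Ck k U f -> Ck k U (fun y => f y 0 i).
Proof.
move=> oU; elim: k f => [|k IH] f.
  move=> cf y Uy; apply: (@continuous_comp _ _ _ f (fun N : 'rV[R]_n => N 0 i)).
    exact: cf.
  exact: coord_continuous.
move=> [df Df]; split=> [y Uy|v]; first exact/differentiable_entry/df.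
apply: (Ck_ext oU _ (IH _ (Df v))) => y Uy; rewrite derivable_row //.
exact: df.
Qed.

End CkTheory.

Lemma derive_comp (R : realType) (V0 V W : normedModType R)
    (F : V -> W) (b : V0 -> V) (t : V0) :
  differentiable b t -> differentiable F (b t) ->
  differentiable (F \o b) t /\
  forall u, 'D_u (F \o b) t = 'D_('D_u b t) F (b t).
Proof.
move=> db dF; have dFb : differentiable (F \o b) t by exact: differentiable_comp.
by split=> // u; rewrite !deriveE // diff_comp.
Qed.

Lemma continuous_dist_le (R : realType) (V : normedModType R) (f : V -> R) y e :
  {for y, continuous f} -> 0 < e -> \forall z \near y, `|f y - f z| <= e.
Proof. by move=> /cvgrPdist_le; apply. Qed.

Lemma dist_le_halves (R : realType) (p q r e : R) :
  `|p - q| <= e / 2 -> `|r - q| <= e / 2 -> `|p - r| <= e.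
Proof.
move=> Hp Hr; rewrite -(subrKA q) (le_trans (ler_normD _ _)) // [leRHS]splitr.
by rewrite lerD // distrC.
Qed.

Lemma difference_swap (R : realType) (p q r s h a b : R) : h != 0 ->
  p - q - (r - s) = h * (h * a) -> p - r - (q - s) = h * (h * b) -> a = b.
Proof.
move=> h0 E1 E2; apply: (mulfI h0); apply: (mulfI h0); rewrite -E1 -E2; ring.
Qed.

(** * Symmetry of second directional derivatives *)

Section Schwarz.
Context {R : realType} {V : normedModType R}.

Lemma mvt_line (F : V -> R) (z v : V) (h : R) : 0 < h ->
  (forall s, 0 <= s <= h -> differentiable F (s *: v + z)) ->
  exists2 c, 0 <= c <= h & F (h *: v + z) - F z = h * 'D_v F (c *: v + z).
Proof.
move=> h0 dF; pose b (s : R) := s *: v + z.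
have db s : differentiable b s /\ 'D_1 b s = v.
  have dZ : differentiable (fun s : R => s *: v) s.
    exact: (@differentiableZl _ _ _ (fun x : R => x)).
  have dC : differentiable (cst z : R -> V) s by [].
  have -> : b = (fun s : R => s *: v) + cst z by [].
  split; first exact: differentiableD.
  rewrite deriveD; [|exact: diff_derivable|exact: diff_derivable].
  rewrite derive_cst addr0 deriveE // (@diffZl _ _ _ (fun x : R => x)) //.
  by rewrite -deriveE // derive_id scale1r.
have dFb s : 0 <= s <= h -> is_derive s 1 (F \o b) ('D_v F (b s)).
  move=> hs; have [H1 H2] := @derive_comp _ _ _ _ F b s (db s).1 (dF s hs).
  by apply: DeriveDef; [exact: diff_derivable|rewrite H2 (db s).2].
have [| |c] := @MVT R (F \o b) (fun s => 'D_v F (b s)) 0 h h0.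
- by move=> x; rewrite in_itv /= => /andP[x0 xh]; apply: dFb; rewrite !ltW.
- apply: derivable_within_continuous => x; rewrite in_itv /= => hx.
  by case: (dFb x hx).
rewrite in_itv /= => /andP[c0 ch]; rewrite /= /b scale0r add0r subr0 => E.
by exists c; [rewrite !ltW|rewrite E mulrC].
Qed.

(** Two mean values: along [v] for the increment [F z = f (h *: w + z) - f z], then along [w] for
    the derivative of [f] along [v]. Smoothness is known on [U] only, so the whole parallelogram
    must lie there. *)
Lemma second_difference (U : set V) (f : V -> R) (y v w : V) (h : R) :
  smooth U f -> 0 < h ->
  (forall s t, 0 <= s <= h -> 0 <= t <= h -> U (s *: v + (t *: w + y))) ->
  exists s t, [/\ 0 <= s <= h, 0 <= t <= h &
    f (h *: v + (h *: w + y)) - f (h *: v + y) - (f (h *: w + y) - f y)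
    = h * (h * 'D_w (fun z => 'D_v f z) (s *: v + (t *: w + y)))].
Proof.
move=> sf h0 hU; pose F z := f (h *: w + z) - f z.
have h00 : (0 : R) <= 0 <= h by rewrite lexx ltW.
have hhh : 0 <= h <= h by rewrite lexx ltW.
have dsh z : U (h *: w + z) -> differentiable (fun x => f (h *: w + x)) z /\
    forall u, 'D_u (fun x => f (h *: w + x)) z = 'D_u f (h *: w + z).
  move=> Uz; have ds : is_diff z (fun x => h *: w + x) id.
    have -> : @id V = 0 + id by apply/funext => x; rewrite !fctE add0r.
    by apply: is_diffD.
  have [H1 H2] := @derive_comp _ _ _ _ f (fun x => h *: w + x) z
    (@ex_diff _ _ _ _ _ _ _ ds) (smooth_differentiable sf Uz).
  have Du u : 'D_u (fun x => h *: w + x) z = u.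
    by rewrite deriveE ?(@diff_val _ _ _ _ _ _ _ ds) //; case: ds.
  by split=> // u; rewrite -[in RHS](Du u); exact: H2.
have [s hs|s hs Es] := @mvt_line F y v h h0.
  apply: (@differentiableB _ _ _ (fun x => f (h *: w + x)) f).
    by apply: (dsh _ _).1; rewrite addrCA; exact: hU.
  apply: smooth_differentiable sf _.
  by have := hU s 0 hs h00; rewrite scale0r add0r.
have Dv := @smooth_derive _ _ _ _ _ v sf.
have [t ht|t ht Et] := @mvt_line (fun z => 'D_v f z) (s *: v + y) w h h0.
  by apply: smooth_differentiable Dv _; rewrite addrCA; exact: hU.
exists s, t; split => //; rewrite (addrCA (s *: v)) -Et.
have -> : f (h *: v + (h *: w + y)) - f (h *: v + y) - (f (h *: w + y) - f y)
  = F (h *: v + y) - F y by rewrite /F (addrCA (h *: v)).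
rewrite Es; congr (h * _).
have Us : U (h *: w + (s *: v + y)) by rewrite addrCA; exact: hU.
have Us' : U (s *: v + y) by have := hU s 0 hs h00; rewrite scale0r add0r.
rewrite (@deriveB _ _ _ (fun x => f (h *: w + x)) f); last 2 first.
- by apply: diff_derivable; exact: (dsh _ Us).1.
- by apply: diff_derivable; exact: smooth_differentiable sf _.
by rewrite (dsh _ Us).2.
Qed.

(** The second difference over a parallelogram is symmetric in [v] and [w], so the two mixed
    derivatives take a common value at two points of it, which need not coincide; when the
    parallelogram is small, continuity compares both with their values at [y]. *)
Lemma derive_sym (U : set V) (f : V -> R) (y v w : V) :
  open U -> smooth U f -> U y ->
  'D_w (fun z => 'D_v f z) y = 'D_v (fun z => 'D_w f z) y.
Proof.
move=> oU sf Uy; apply/eqP; rewrite -subr_eq0 -normr_le0; apply/ler_addgt0Pl => e e0.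
pose a z := 'D_w (fun z => 'D_v f z) z; pose b z := 'D_v (fun z => 'D_w f z) z.
have ca := smooth_continuous (smooth_derive w (smooth_derive v sf)) Uy.
have cb := smooth_continuous (smooth_derive v (smooth_derive w sf)) Uy.
have e20 : 0 < e / 2 by rewrite divr_gt0.
have : \forall z \near y, U z /\ (`|a y - a z| <= e / 2 /\ `|b y - b z| <= e / 2).
  apply: filterI; first exact: open_nbhs_nbhs.
  by apply: filterI; [exact: (continuous_dist_le ca)|exact: (continuous_dist_le cb)].
move=> /nbhs_ballP[d /= d0 hd].
(* Small enough for the parallelogram to stay in the ball of radius [d]; the summand 1 keeps the
   denominator positive when [v] and [w] vanish. *)
pose h := d / (2 * (`|v| + `|w| + 1)).
have vw0 : 0 < `|v| + `|w| + 1 by rewrite ltr_wpDl // addr_ge0.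
have h0 : 0 < h by rewrite divr_gt0 // mulr_gt0.
have hB s t : 0 <= s <= h -> 0 <= t <= h -> ball y d (s *: v + (t *: w + y)).
  move=> /andP[s0 sh] /andP[t0 th]; rewrite -ball_normE /=.
  have -> : y - (s *: v + (t *: w + y)) = - (s *: v + t *: w).
    by rewrite addrA opprD addrCA subrr addr0.
  rewrite normrN (le_lt_trans (ler_normD _ _)) // !normrZ !ger0_norm //.
  apply: (@le_lt_trans _ _ (h * (`|v| + `|w| + 1))).
    rewrite !mulrDr -addrA; apply: lerD; first exact: ler_wpM2r.
    by rewrite ler_wpDr ?mulr1 ?(ltW h0) // ler_wpM2r.
  rewrite /h -mulrA invfM -[_ * _ * (_ + _)]mulrA mulVf ?gt_eqF // mulr1.
  by rewrite ltr_pdivrMr // ltr_pMr // ltr1n.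
have [s [t [hs ht E1]]] := @second_difference U f y v w h sf h0
  (fun s t hs ht => (hd _ (hB s t hs ht)).1).
have hB' s' t' : 0 <= s' <= h -> 0 <= t' <= h -> ball y d (s' *: w + (t' *: v + y)).
  by move=> hs' ht'; rewrite addrCA; exact: hB.
have [t' [s' [ht' hs' E2]]] := @second_difference U f y w v h sf h0
  (fun s t hs ht => (hd _ (hB' s t hs ht)).1).
have E : a (s *: v + (t *: w + y)) = b (t' *: w + (s' *: v + y)).
  rewrite (addrCA (h *: w)) in E2.
  by apply: (difference_swap _ E1 E2); rewrite gt_eqF.
have [_ [Ha _]] := hd _ (hB s t hs ht).
have [_ [_ Hb]] := hd _ (hB' t' s' ht' hs').
by rewrite addr0; move: Ha; rewrite E => Ha; exact: (dist_le_halves Ha Hb).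
Qed.

End Schwarz.

(** * Differentiability of a map lifted through an immersion *)

Section Lift.
Context {R : realType}.

(* The key estimate is [tau (t + h) - tau t = O(h)], which follows from the
   continuity of [tau]. *)
Lemma differentiable_lift (V0 V : normedModType R) (q : V -> V) (tau : V0 -> V)
    (t : V0) : {for t, continuous tau} -> differentiable q (tau t) ->
  (forall v, 'd q (tau t) v = v) -> differentiable (q \o tau) t ->
  differentiable tau t.
Proof.
move=> ct dq qid dqt; set D := 'd (q \o tau) t.
have cD : continuous D by exact: diff_continuous.
have [K K0 DK] := linear_lipschitz cD.
have tE : tau \o shift t = cst (tau t) + D +o_ 0 id.
  apply/eqaddoP => _ /posnumP[e].
  (* With [k] the increment of [tau], the two expansions give |k - D h| <= e1 |k| + e2 |h|. The
     bounds e1 <= 1/2 and e2 <= 1 absorb |k| into the left side, so |k| <= 2 (K + 1) |h|; the other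
     two bounds then make each error term at most e/2 |h|. *)
  pose e2 := Num.min (e%:num / 2) 1.
  pose e1 := Num.min (2^-1) (e%:num / (4 * (K + 1))).
  have K10 : 0 < K + 1 by rewrite addr_gt0.
  have e20 : 0 < e2 by rewrite lt_min divr_gt0 //= ltr01.
  have e10 : 0 < e1 by rewrite lt_min invr_gt0 ltr0n divr_gt0 // mulr_gt0.
  have /eqaddoP/(_ e1 e10) Hq := diff_locally dq.
  have /eqaddoP/(_ e2 e20) Ht := diff_locally dqt.
  have ck : (fun h => tau (h + t) - tau t) @ 0 --> (0 : V).
    rewrite -(subrr (tau t)); apply: cvgB; last exact: cvg_cst.
    apply: (@cvg_comp _ _ _ (fun h => h + t) tau _ (nbhs t)); last exact: ct.
    have : (fun h : V0 => h + t) @ (0 : V0) --> (0 + t : V0).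
      by apply: cvgD; [exact: cvg_id|exact: cvg_cst].
    by rewrite add0r.
  have Hk := ck _ Hq; near=> h.
  have : `|(q \o shift (tau t) - (cst (q (tau t)) + 'd q (tau t)))
    (tau (h + t) - tau t)| <= e1 * `|tau (h + t) - tau t| by near: h; exact: Hk.
  have : `|((q \o tau) \o shift t - (cst ((q \o tau) t) + D)) h| <= e2 * `|h|.
    by near: h; exact: Ht.
  rewrite !fctE /= subrK qid; set k := tau (h + t) - tau t => A1 A2.
  have -> : tau (h + t) - (tau t + D h) = k - D h by rewrite /k opprD addrA.
  have A3 : `|k - D h| <= e1 * `|k| + e2 * `|h|.
    rewrite -(subrKA (q (tau (h + t)) - q (tau t))).
    rewrite (le_trans (ler_normD _ _)) // lerD //.
      by rewrite distrC; move: A2; rewrite opprD addrA.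
    by move: A1; rewrite opprD addrA.
  have A4 : `|k| <= `|k - D h| + `|D h| by rewrite -{1}(subrK (D h) k) ler_normD.
  have e1h : e1 <= 2^-1 by rewrite ge_min lexx.
  have e21 : e2 <= 1 by rewrite ge_min lexx orbT.
  have e22 : e2 <= e%:num / 2 by rewrite ge_min lexx.
  have e12 : e1 * (4 * (K + 1)) <= e%:num.
    by rewrite -ler_pdivlMr ?mulr_gt0 // ge_min lexx orbT.
  have A5 := DK h; have n0 := normr_ge0 h; have k0 := normr_ge0 k.
  have A6 : `|k| <= 2 * (K + 1) * `|h|.
    have : e1 * `|k| <= 2^-1 * `|k| by exact: ler_wpM2r.
    have : e2 * `|h| <= 1 * `|h| by exact: ler_wpM2r.
    lra.
  have : e1 * `|k| <= e1 * (2 * (K + 1) * `|h|) by rewrite ler_pM2l.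
  have : e2 * `|h| <= e%:num / 2 * `|h| by exact: ler_wpM2r.
  have : e1 * (4 * (K + 1)) * `|h| <= e%:num * `|h| by exact: ler_wpM2r.
  lra.
apply/diff_locallyP.
by rewrite (diff_unique cD tE); split.
Unshelve. all: by end_near. Qed.

End Lift.

Section Dot.
Context {R : realType} {V : normedModType R} {n : nat}.
Implicit Types f g : V -> 'rV[R]_n.

Lemma dotC (v w : 'rV[R]_n) : dot v w = dot w v.
Proof. by apply: eq_bigr => i _; rewrite mulrC. Qed.

Lemma dotDl (u v w : 'rV[R]_n) : dot (u + v) w = dot u w + dot v w.
Proof. by rewrite -big_split; apply: eq_bigr => i _; rewrite !mxE mulrDl. Qed.

Lemma dotDr (u v w : 'rV[R]_n) : dot w (u + v) = dot w u + dot w v.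
Proof. by rewrite dotC dotDl !(dotC w). Qed.

Lemma dotZl a (u w : 'rV[R]_n) : dot (a *: u) w = a * dot u w.
Proof. by rewrite mulr_sumr; apply: eq_bigr => i _; rewrite !mxE mulrA. Qed.

Lemma dotZr a (u w : 'rV[R]_n) : dot w (a *: u) = a * dot w u.
Proof. by rewrite dotC dotZl dotC. Qed.

Lemma dotNl (u w : 'rV[R]_n) : dot (- u) w = - dot u w.
Proof. by rewrite -scaleN1r dotZl mulN1r. Qed.

Lemma dotNr (u w : 'rV[R]_n) : dot w (- u) = - dot w u.
Proof. by rewrite dotC dotNl dotC. Qed.

Lemma Ck_dot k (U : set V) f g : open U -> Ck k U f -> Ck k U g ->
  Ck k U (fun y => dot (f y) (g y)).
Proof. by move=> oU Cf Cg; apply: Ck_sum => // i; apply: CkM => //; exact: Ck_entry. Qed.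

Lemma smooth_dot (U : set V) f g : open U -> smooth U f -> smooth U g ->
  smooth U (fun y => dot (f y) (g y)).
Proof. by move=> oU sf sg k; exact: Ck_dot. Qed.

Lemma derive_dot f g y v : differentiable f y -> differentiable g y ->
  'D_v (fun z => dot (f z) (g z)) y = dot ('D_v f y) (g y) + dot (f y) ('D_v g y).
Proof.
move=> df dg; have dfi i := differentiable_entry i df.
have dgi i := differentiable_entry i dg.
have -> : (fun z => dot (f z) (g z)) =
  \sum_(i < n) ((fun z => f z 0 i) * (fun z => g z 0 i)).
  by apply/funext => z; rewrite fct_sumE.
rewrite derive_sum => [|i]; last by apply: derivableM; exact: diff_derivable.
rewrite -big_split; apply: eq_bigr => i _.
rewrite deriveM; try exact: diff_derivable.
by rewrite (derivable_row v df) (derivable_row v dg) addrC; congr (_ + _); exact: mulrC.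
Qed.

End Dot.

Lemma derive_row_sum (R : realType) (W : normedModType R) n
    (F : 'rV[R]_n -> W) y xi : differentiable F y ->
  'D_xi F y = \sum_(i < n) xi 0 i *: 'D_(delta_mx 0 i) F y.
Proof.
move=> dF; rewrite deriveE // {1}[xi]row_sum_delta linear_sum.
by apply: eq_bigr => i _; rewrite linearZ deriveE.
Qed.

Lemma Ck_comp (R : realType) (V0 : normedModType R) n k (V : set V0)
    (U : set 'rV[R]_n) (F : 'rV[R]_n -> R) (b : V0 -> 'rV[R]_n) :
  open V -> (forall s, V s -> U (b s)) -> smooth U F -> Ck k V b ->
  Ck k V (fun s => F (b s)).
Proof.
move=> oV bU; elim: k F => [|k IH] F sF Cb.
  move=> s Vs; apply: (@continuous_comp _ _ _ b F); first exact: Cb.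
  by apply: smooth_continuous sF _; exact: bU.
have /CkS[db Db] := Cb; apply/CkS; split=> [s Vs|v].
  apply: (derive_comp (db s Vs) _).1.
  by apply: smooth_differentiable sF _; exact: bU.
apply: (@Ck_ext _ _ _ _ _ (fun s => \sum_(i < n) ('D_v b s) 0 i *
    (fun y => 'D_(delta_mx 0 i) F y) (b s))) => // [s Vs|].
  have dF : differentiable F (b s) by apply: smooth_differentiable sF _; exact: bU.
  by have -> := (derive_comp (db s Vs) dF).2 v; rewrite derive_row_sum.
apply: Ck_sum => // i; apply: CkM => //; first exact: Ck_entry.
apply: (IH (fun y => 'D_(delta_mx 0 i) F y)); last exact: Ck_pred.
exact: smooth_derive.
Qed.

(* That [F] is an immersion is encoded by [l], a smooth left inverse of its
   differential. *)
Lemma smooth_lift (R : realType) (V0 : normedModType R) n m (V : set V0)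
    (U : set 'rV[R]_n) (F : 'rV[R]_n -> 'rV[R]_m) (l : 'I_n -> 'rV[R]_n -> 'rV[R]_m)
    (tau : V0 -> 'rV[R]_n) (gam : V0 -> 'rV[R]_m) :
  open V -> open U -> smooth U F -> (forall i, smooth U (l i)) ->
  (forall y, U y -> forall xi i, dot (l i y) ('D_xi F y) = xi 0 i) ->
  smooth V gam -> (forall s, V s -> U (tau s) /\ F (tau s) = gam s) ->
  (forall s, V s -> {for s, continuous tau}) ->
  smooth V tau.
Proof.
move=> oV oU sF sl lF sg tF ct.
have dtau t : V t -> differentiable tau t.
  move=> Vt; have [Ut _] := tF t Vt.
  (* The left inverse of the differential, frozen at [tau t]. Composed with [F] it has the identity
     as differential at [tau t], and composed with [gam] it is differentiable, as
     [differentiable_lift] requires. *)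
  pose L := \matrix_(j < m, i < n) l i (tau t) 0 j.
  have LE w : w *m L = \row_i dot (l i (tau t)) w.
    apply/rowP => i; rewrite !mxE; apply: eq_bigr => j _.
    by rewrite !mxE mulrC.
  have cL : continuous (mulmxr L : 'rV[R]_m -> 'rV[R]_n).
    move=> w; apply: differentiable_continuous.
    have -> : (mulmxr L : 'rV[R]_m -> 'rV[R]_n) =
      \sum_(i < n) (fun w => (dot (l i (tau t)) w) *: (delta_mx 0 i)).
      apply/funext => w'; rewrite fct_sumE /= LE [LHS]row_sum_delta.
      by apply: eq_bigr => i _; rewrite mxE.
    apply: differentiable_sum => i; apply: differentiableZl.
    rewrite (_ : dot _ =
      \sum_(j < m) (fun w' : 'rV[R]_m => l i (tau t) 0 j *: (w' 0 j : R^o))).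
      apply: differentiable_sum => j; apply: differentiableZ.
      exact: differentiable_coord.
    by apply/funext => w'; rewrite fct_sumE.
  have dL w : differentiable (mulmxr L : 'rV[R]_m -> 'rV[R]_n) w.
    exact: linear_differentiable.
  have dF : differentiable F (tau t) by exact: smooth_differentiable sF _.
  apply: (@differentiable_lift _ _ _ (mulmxr L \o F)) => //.
  - exact: ct.
  - exact: differentiable_comp.
  - move=> v; rewrite diff_comp //= diff_lin // -deriveE //= LE.
    by apply/rowP => i; rewrite mxE lF.
  - apply: (@near_eq_differentiable _ _ _ (mulmxr L \o gam)).
      near=> s; rewrite /= (tF s _).2 //; near: s; exact: open_nbhs_nbhs.
    by apply: differentiable_comp => //; exact: smooth_differentiable sg _.
(* Bootstrap: entry [i] of ['D_v tau s] equals [dot (l i (tau s)) ('D_v gam s)], which is of class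
   C^k as soon as [tau] is. *)
elim=> [|k IH]; first exact: ct.
apply/CkS; split=> // v; apply: Ck_row => // i.
apply: (@Ck_ext _ _ _ _ _ (fun s => dot (l i (tau s)) ('D_v gam s))) => // [s Vs|].
  have [Us _] := tF s Vs; rewrite -(lF _ Us).
  rewrite -(derive_comp (dtau s Vs) (smooth_differentiable sF Us)).2.
  congr dot; apply: near_eq_derive; near=> r; rewrite /= (tF r _).2 //.
  by near: r; exact: open_nbhs_nbhs.
apply: Ck_dot => //; last by have [_] := sg k.+1; exact.
apply: Ck_row => // j; apply: (@Ck_comp _ _ _ _ _ U (fun y => l i y 0 j)) => //.
  by move=> s /tF[].
by move=> k'; exact: (Ck_entry j oU (sl i k')).
Unshelve. all: by end_near. Qed.

Lemma is_derive_addf (R : realType) (V : normedModType R) (f g : V -> R) y v df dg :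
  is_derive y v f df -> is_derive y v g dg ->
  is_derive y v (fun z => f z + g z) (df + dg).
Proof. exact: is_deriveD. Qed.

Lemma is_derive_oppf (R : realType) (V : normedModType R) (f : V -> R) y v df :
  is_derive y v f df -> is_derive y v (fun z => - f z) (- df).
Proof. exact: is_deriveN. Qed.

Lemma is_derive_mulf (R : realType) (V : normedModType R) (f g : V -> R) y v df dg :
  is_derive y v f df -> is_derive y v g dg ->
  is_derive y v (fun z => f z * g z) (df * g y + f y * dg).
Proof.
move=> Hf Hg; have := @is_deriveM _ _ f g y v df dg Hf Hg.
by rewrite addrC [g y *: df]mulrC.
Qed.

(* A sealed directional derivative: unification would otherwise unfold the
   limit defining ['D_v f y]. *)
HB.lock Definition dd (R : realType) (V W : normedModType R) (v : V) (f : V -> W)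
  (y : V) : W := 'D_v f y.

Section SealedDerivative.
Context {R : realType} {V : normedModType R}.

Lemma ddE (W : normedModType R) (v : V) (f : V -> W) y : dd v f y = 'D_v f y.
Proof. by rewrite dd.unlock. Qed.

Lemma dd_val (W : normedModType R) (f : V -> W) y v df :
  is_derive y v f df -> dd v f y = df.
Proof. by rewrite ddE => H; exact: derive_val. Qed.

Lemma dd_near (W : normedModType R) (f g : V -> W) y v :
  (\near y, f y = g y) -> dd v f y = dd v g y.
Proof. by rewrite !ddE; exact: near_eq_derive. Qed.

Lemma dd_cst (W : normedModType R) (w : W) (y v : V) : dd v (cst w) y = 0.
Proof. by rewrite ddE; exact: derive_cst. Qed.

Lemma differentiable_is_dd (W : normedModType R) (f : V -> W) y v :
  differentiable f y -> is_derive y v f (dd v f y).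
Proof. by move=> df; rewrite ddE; exact/derivableP/diff_derivable. Qed.

Lemma smooth_is_dd (W : normedModType R) U (f : V -> W) y v :
  smooth U f -> U y -> is_derive y v f (dd v f y).
Proof. by move=> sf Uy; exact/differentiable_is_dd/(smooth_differentiable sf). Qed.

Lemma smooth_dd (W : normedModType R) U (f : V -> W) v :
  smooth U f -> smooth U (dd v f).
Proof.
have -> : dd v f = (fun y => 'D_v f y) by apply/funext => y; rewrite ddE.
exact: smooth_derive.
Qed.

Lemma dd_comb (W : normedModType R) (F : V -> W) y a b u v :
  differentiable F y -> dd (a *: u + b *: v) F y = a *: dd u F y + b *: dd v F y.
Proof. by move=> dF; rewrite !ddE !deriveE // linearD !linearZ. Qed.

Lemma dd_sym (U : set V) (f : V -> R) y v w : open U -> smooth U f -> U y ->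
  dd w (dd v f) y = dd v (dd w f) y.
Proof.
have E x : dd x f = (fun y => 'D_x f y) by apply/funext => z; rewrite ddE.
by rewrite !E !ddE; exact: derive_sym.
Qed.

Lemma dd_entry n (f : V -> 'rV[R]_n) y v i : differentiable f y ->
  (dd v f y) 0 i = dd v (fun z => f z 0 i) y.
Proof. by move=> df; rewrite !ddE derivable_row. Qed.

Lemma dd_sym_row n (U : set V) (f : V -> 'rV[R]_n) y v w :
  open U -> smooth U f -> U y -> dd w (dd v f) y = dd v (dd w f) y.
Proof.
move=> oU sf Uy; have dD x : differentiable (dd x f) y.
  exact: smooth_differentiable (smooth_dd x sf) Uy.
have Ei x x' i : (dd x' (dd x f) y) 0 i = dd x' (dd x (fun z => f z 0 i)) y.
  rewrite (dd_entry _ _ (dD x)); apply: dd_near.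
  near=> z; rewrite dd_entry //; apply: (smooth_differentiable sf).
  by near: z; exact: open_nbhs_nbhs.
apply/rowP => i; apply: (etrans (Ei v w i)); apply: (etrans _ (esym (Ei w v i))).
exact: (dd_sym v w oU (fun k => Ck_entry i oU (sf k)) Uy).
Unshelve. all: by end_near. Qed.

Lemma is_dd_dot n (f g : V -> 'rV[R]_n) y v :
  differentiable f y -> differentiable g y ->
  is_derive y v (fun z => dot (f z) (g z)) (dot (dd v f y) (g y) + dot (f y) (dd v g y)).
Proof.
move=> df dg; rewrite !ddE -derive_dot //; apply/derivableP.
have -> : (fun z => dot (f z) (g z)) =
  \sum_(i < n) ((fun z => f z 0 i) * (fun z => g z 0 i)).
  by apply/funext => z; rewrite fct_sumE.
apply: derivable_sum => i; apply: derivableM; apply: diff_derivable;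
  exact: differentiable_entry.
Qed.

Lemma dd_dot_const n (f g : V -> 'rV[R]_n) c y v :
  differentiable f y -> differentiable g y -> (forall z, dot (f z) (g z) = c) ->
  dot (dd v f y) (g y) = - dot (f y) (dd v g y).
Proof.
move=> df dg fg; apply/eqP; rewrite -subr_eq0 opprK.
rewrite -(dd_val (is_dd_dot v df dg)).
by rewrite (_ : (fun z => _) = cst c) ?dd_cst //; apply/funext => z; exact: fg.
Qed.

Lemma dd_dot_unit n (f : V -> 'rV[R]_n) c y v :
  differentiable f y -> (forall z, dot (f z) (f z) = c) -> dot (f y) (dd v f y) = 0.
Proof.
move=> df ff; have := dd_dot_const v df df ff.
by rewrite dotC => /eqP; rewrite -subr_eq0 opprK -mulr2n mulrn_eq0 /= => /eqP.
Qed.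

End SealedDerivative.

(** * Moving frames in a chart *)

Section OrthonormalFrame.
Context {R : realType} (E1 E2 E3 : 'rV[R]_3).
Hypothesis unitE : [/\ dot E1 E1 = 1, dot E2 E2 = 1 & dot E3 E3 = 1].
Hypothesis orthoE : [/\ dot E1 E2 = 0, dot E1 E3 = 0 & dot E2 E3 = 0].

(** The matrix [P] with rows [E1], [E2], [E3] satisfies P P^T = 1; being square it also satisfies
    P^T P = 1, which is the expansion. *)
Lemma frame_expand (w : 'rV[R]_3) :
  w = dot E1 w *: E1 + dot E2 w *: E2 + dot E3 w *: E3.
Proof.
case: unitE => u1 u2 u3; case: orthoE => o12 o13 o23.
pose r (i : 'I_3) := [:: E1; E2; E3]`_i.
pose P := \matrix_i r i.
have PE v i : (v *m P^T) 0 i = dot (r i) v.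
  by rewrite mxE; apply: eq_bigr => j _; rewrite !mxE mulrC.
have PP : P *m P^T = 1%:M.
  apply/matrixP => i j.
  have -> : (P *m P^T) i j = dot (r j) (r i).
    by rewrite mxE; apply: eq_bigr => k _; rewrite !mxE mulrC.
  rewrite mxE; case: i => [[|[|[|//]]] hi]; case: j => [[|[|[|//]]] hj];
    by rewrite /r /= ?u1 ?u2 ?u3 ?o12 ?o13 ?o23 // dotC ?o12 ?o13 ?o23.
have {1}-> : w = w *m P^T *m P by rewrite -mulmxA (mulmx1C PP) mulmx1.
rewrite mulmx_sum_row !big_ord_recl big_ord0 addr0 !rowK !PE.
by rewrite /r /= addrA.
Qed.

Lemma frame_parseval (v w : 'rV[R]_3) :
  dot v w = dot E1 v * dot E1 w + dot E2 v * dot E2 w + dot E3 v * dot E3 w.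
Proof. by rewrite {1}(frame_expand v) !dotDl !dotZl. Qed.

End OrthonormalFrame.

Lemma delta2_expand (R : realType) (xi : 'rV[R]_2) :
  xi = xi 0 0 *: delta_mx 0 0 + xi 0 1 *: delta_mx 0 1.
Proof.
have E : lift (@ord0 1) ord0 = 1 :> 'I_2 by exact: val_inj.
by rewrite [LHS]row_sum_delta big_ord_recl big_ord1 E.
Qed.

Lemma dot_comb (R : realType) n (w u v : 'rV[R]_n) a b :
  dot w (a *: u + b *: v) = a * dot w u + b * dot w v.
Proof. by rewrite dotDr !dotZr. Qed.

(** The pullback of omega1 by the parametrization, evaluated at [y] on the direction [xi]; sealed,
    like [dd], so that it remains an atom in computations. *)
HB.lock Definition om1 (R : realType) (M : framed_surface R) (phi : 'rV[R]_2 -> M)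
  (xi y : 'rV[R]_2) : R := dot (e1 (phi y)) (dd xi (@pos R M \o phi) y).
HB.lock Definition om2 (R : realType) (M : framed_surface R) (phi : 'rV[R]_2 -> M)
  (xi y : 'rV[R]_2) : R := dot (e2 (phi y)) (dd xi (@pos R M \o phi) y).

Lemma om1E (R : realType) (M : framed_surface R) (phi : 'rV[R]_2 -> M) xi :
  om1 phi xi = fun y => dot (e1 (phi y)) (dd xi (@pos R M \o phi) y).
Proof. by rewrite om1.unlock. Qed.

Lemma om2E (R : realType) (M : framed_surface R) (phi : 'rV[R]_2 -> M) xi :
  om2 phi xi = fun y => dot (e2 (phi y)) (dd xi (@pos R M \o phi) y).
Proof. by rewrite om2.unlock. Qed.

Section Chart.
Context {R : realType} {M : framed_surface R}.
Context {U : set 'rV[R]_2} {phi : 'rV[R]_2 -> M}.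
Hypothesis cU : chart (@pos R M) U phi.

Notation X := (@pos R M \o phi).
Notation d0 := (delta_mx 0 0 : 'rV[R]_2).
Notation d1 := (delta_mx 0 1 : 'rV[R]_2).
Notation om1 := (om1 phi).
Notation om2 := (om2 phi).

(** The value of omega1 /\ omega2 on the two coordinate directions, a common factor of the two-form
    identities below. *)
Definition omdet (y : 'rV[R]_2) : R := om1 d0 y * om2 d1 y - om1 d1 y * om2 d0 y.

Lemma chart_open : open U. Proof. by case: cU. Qed.

Lemma chart_smooth : smooth U (@pos R M \o phi). Proof. by case: cU => _ _ _ _ []. Qed.

Lemma chart_immersion y xi : U y -> 'D_xi (@pos R M \o phi) y = 0 -> xi = 0.
Proof. by case: cU => _ _ _ _ [_ H] Uy; exact: H. Qed.

Lemma smooth_pull (W : normedModType R) (g : M -> W) :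
  smooth_on setT g -> smooth U (g \o phi).
Proof. by move=> sg; apply: smooth_sub (sg U phi cU) => y Uy; split. Qed.

Lemma smooth_e1 : smooth U (@e1 R M \o phi).
Proof. by apply: smooth_pull; case: (e_smooth M). Qed.

Lemma smooth_e2 : smooth U (@e2 R M \o phi).
Proof. by apply: smooth_pull; case: (e_smooth M). Qed.

Lemma smooth_e3 : smooth U (@e3 R M \o phi).
Proof. by apply: smooth_pull; case: (e_smooth M). Qed.

Lemma smooth_om1 xi : smooth U (om1 xi).
Proof.
rewrite om1E; apply: smooth_dot; [exact: chart_open|exact: smooth_e1|].
exact: smooth_dd chart_smooth.
Qed.

Lemma smooth_om2 xi : smooth U (om2 xi).
Proof.
rewrite om2E; apply: smooth_dot; [exact: chart_open|exact: smooth_e2|].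
exact: smooth_dd chart_smooth.
Qed.

Lemma tangent_expand y xi : U y ->
  dd xi X y = om1 xi y *: e1 (phi y) + om2 xi y *: e2 (phi y).
Proof.
move=> Uy; rewrite {1}(frame_expand (e_unit (phi y)) (e_ortho (phi y)) (dd xi X y)).
by rewrite [in dot (e3 _) _]ddE (e3_normal cU Uy) scale0r addr0 om1E om2E.
Qed.

Lemma om1_comb y a b u v : U y -> om1 (a *: u + b *: v) y = a * om1 u y + b * om1 v y.
Proof.
move=> Uy; rewrite !om1E dd_comb; last exact: smooth_differentiable chart_smooth Uy.
exact: dot_comb.
Qed.

Lemma om2_comb y a b u v : U y -> om2 (a *: u + b *: v) y = a * om2 u y + b * om2 v y.
Proof.
move=> Uy; rewrite !om2E dd_comb; last exact: smooth_differentiable chart_smooth Uy.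
exact: dot_comb.
Qed.

Lemma om_inj y xi eta : U y -> om1 xi y = om1 eta y -> om2 xi y = om2 eta y -> xi = eta.
Proof.
move=> Uy E1 E2; apply/eqP; rewrite -subr_eq0; apply/eqP; apply: (chart_immersion Uy).
rewrite -ddE tangent_expand // -(scaleN1r eta) -(scale1r xi) om1_comb // om2_comb // E1 E2.
by rewrite !mulN1r !mul1r !subrr !scale0r addr0.
Qed.

(** If the determinant vanishes, the combinations of [d0] and [d1] formed with either row of the
    coframe matrix lie in the kernel of the immersion; injectivity makes both rows zero, and then
    [d0] itself. *)
Lemma omdet_neq0 y : U y -> omdet y != 0.
Proof.
move=> Uy; apply/eqP => D0.
have K a b c d : om1 (a *: d0 + b *: d1) y = om1 (c *: d0 + d *: d1) y ->
   om2 (a *: d0 + b *: d1) y = om2 (c *: d0 + d *: d1) y -> a = c /\ b = d.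
  move=> E1 E2; have := om_inj Uy E1 E2 => /rowP E.
  have := E 0; have := E 1; rewrite !mxE /= !mulr1 !mulr0 !addr0 !add0r => -> ->.
  by [].
have [||A1 A2] := K (- om1 d1 y) (om1 d0 y) 0 0.
- by rewrite !om1_comb //; ring.
- by rewrite !om2_comb // !mul0r addr0; move: D0; rewrite /omdet => <-; ring.
have [||B1 B2] := K (- om2 d1 y) (om2 d0 y) 0 0.
- by rewrite !om1_comb // !mul0r addr0; move: D0; rewrite /omdet => D0; lra.
- by rewrite !om2_comb //; ring.
have [||/eqP] := K 1 0 0 0; last by rewrite oner_eq0.
- by rewrite !om1_comb // A2; ring.
- by rewrite !om2_comb // B2; ring.
Qed.

Lemma om_surj y a b : U y -> exists xi, om1 xi y = a /\ om2 xi y = b.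
Proof.
move=> Uy; have D := omdet_neq0 Uy.
exists (((a * om2 d1 y - b * om1 d1 y) / omdet y) *: d0 +
        ((b * om1 d0 y - a * om2 d0 y) / omdet y) *: d1).
by rewrite om1_comb // om2_comb //; move: D; rewrite /omdet => D; split; field.
Qed.

Lemma has_extd_dd (w : form1 M) (eta : form2 M) y c0 c1 : has_extd w eta -> U y ->
  (forall z, c0 z = w (phi z) (dd d0 X z)) -> (forall z, c1 z = w (phi z) (dd d1 X z)) ->
  dd d0 c1 y - dd d1 c0 y = eta (phi y) (dd d0 X y) (dd d1 X y).
Proof.
move=> H Uy E0 E1; have [_ _] := H U phi cU y Uy.
have -> : c0 = (fun z => w (phi z) (coordv phi 0 z)).
  by apply/funext => z; rewrite E0 ddE.
have -> : c1 = (fun z => w (phi z) (coordv phi 1 z)).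
  by apply/funext => z; rewrite E1 ddE.
by rewrite !ddE.
Qed.

Lemma structure1_chart y : U y ->
  dd d0 (om1 d1) y - dd d1 (om1 d0) y = hh (phi y) * omdet y.
Proof.
move=> Uy; have /= := @has_extd_dd _ _ y (om1 d0) (om1 d1) (@structure_eq1 R M) Uy.
rewrite om1E => ->; rewrite ?om1E //.
by rewrite /wedge /omdet !om1E !om2E; ring.
Qed.

Lemma structure2_chart y : U y ->
  dd d0 (om2 d1) y - dd d1 (om2 d0) y = kk (phi y) * omdet y.
Proof.
move=> Uy; have /= := @has_extd_dd _ _ y (om2 d0) (om2 d1) (@structure_eq2 R M) Uy.
rewrite om2E => ->; rewrite ?om2E //.
by rewrite /wedge /omdet !om1E !om2E; ring.
Qed.

(** [principal] only speaks of directions whose image is exactly [e1] or [e2]. These are [xi1] and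
    [xi2], and [xi] is their combination with coefficients [om1 xi y] and [om2 xi y]. *)
Lemma weingarten y xi : U y ->
  dd xi (@e3 R M \o phi) y =
  - (ka (phi y) * om1 xi y) *: e1 (phi y) - (kc (phi y) * om2 xi y) *: e2 (phi y).
Proof.
move=> Uy; have [xi1 [x11 x12]] := om_surj 1 0 Uy.
have [xi2 [x21 x22]] := om_surj 0 1 Uy.
have -> : xi = om1 xi y *: xi1 + om2 xi y *: xi2.
  by apply: (om_inj Uy); rewrite ?om1_comb ?om2_comb // ?x11 ?x12 ?x21 ?x22; ring.
rewrite dd_comb; last exact: smooth_differentiable smooth_e3 Uy.
have P1 : - dd xi1 (@e3 R M \o phi) y = ka (phi y) *: e1 (phi y).
  by rewrite ddE; apply: (e1_principal cU Uy); rewrite -ddE tangent_expand // x11 x12 scale1r scale0r addr0.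
have P2 : - dd xi2 (@e3 R M \o phi) y = kc (phi y) *: e2 (phi y).
  by rewrite ddE; apply: (e2_principal cU Uy); rewrite -ddE tangent_expand // x21 x22 scale1r scale0r add0r.
rewrite om1_comb // om2_comb // x11 x12 x21 x22 !mulr1 !mulr0 addr0 add0r.
rewrite -[in LHS](opprK (dd xi1 _ _)) -[in LHS](opprK (dd xi2 _ _)) P1 P2.
by rewrite !scalerN !scalerA scaleNr [ka _ * _]mulrC [kc _ * _]mulrC.
Qed.

(* The forms [dot de1 e2] and omega12 satisfy the same structure equations. *)
Lemma connection_chart y xi : U y ->
  dot (dd xi (@e1 R M \o phi) y) (e2 (phi y)) =
  hh (phi y) * om1 xi y + kk (phi y) * om2 xi y.
Proof.
move=> Uy; have oU := chart_open.
have dX x : differentiable (dd x X) y.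
  exact: smooth_differentiable (smooth_dd x chart_smooth) Uy.
have dE1 := smooth_differentiable smooth_e1 Uy.
have dE2 := smooth_differentiable smooth_e2 Uy.
have G11 x : dot (dd x (@e1 R M \o phi) y) (e1 (phi y)) = 0.
  rewrite dotC; apply: (@dd_dot_unit _ _ _ (@e1 R M \o phi) 1) => // z /=.
  by case: (e_unit (phi z)).
have G22 x : dot (dd x (@e2 R M \o phi) y) (e2 (phi y)) = 0.
  rewrite dotC; apply: (@dd_dot_unit _ _ _ (@e2 R M \o phi) 1) => // z /=.
  by case: (e_unit (phi z)).
have G21 x : dot (dd x (@e2 R M \o phi) y) (e1 (phi y)) =
    - dot (dd x (@e1 R M \o phi) y) (e2 (phi y)).
  rewrite [in RHS]dotC; apply: (@dd_dot_const _ _ _ (@e2 R M \o phi) (@e1 R M \o phi) 0) => //.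
  by move=> z /=; rewrite dotC; case: (e_ortho (phi z)).
have S1 := structure1_chart Uy; have S2 := structure2_chart Uy.
(* Symmetry of the second derivatives of the position makes them cancel in both structure
   equations. *)
have XX := dd_sym_row d0 d1 oU chart_smooth Uy.
have om1D x x' : dd x' (om1 x) y = dot (dd x' (@e1 R M \o phi) y) (dd x X y) +
    dot (e1 (phi y)) (dd x' (dd x X) y).
  by rewrite om1E; exact: (dd_val (is_dd_dot x' dE1 (dX x))).
have om2D x x' : dd x' (om2 x) y = dot (dd x' (@e2 R M \o phi) y) (dd x X y) +
    dot (e2 (phi y)) (dd x' (dd x X) y).
  by rewrite om2E; exact: (dd_val (is_dd_dot x' dE2 (dX x))).
rewrite !om1D XX !tangent_expand // !dotDr !dotZr !G11 in S1.
rewrite !om2D XX !tangent_expand // !dotDr !dotZr !G22 !G21 in S2.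
rewrite [xi]delta2_expand dd_comb // dotDl !dotZl om1_comb // om2_comb //.
have D := omdet_neq0 Uy.
set g0 := dot (dd d0 (@e1 R M \o phi) y) _ in S1 S2 *.
set g1 := dot (dd d1 (@e1 R M \o phi) y) _ in S1 S2 *.
(* Cramer's rule: the structure equations prescribe the wedge products of [dot de1 e2] with omega2
   and with omega1, a linear system for [g0] and [g1] of determinant [omdet y]. *)
have E0 : g0 = hh (phi y) * om1 d0 y + kk (phi y) * om2 d0 y.
  apply: (mulfI D); move: S1 S2; rewrite /omdet /= => S1 S2.
  have T1 : om1 d0 y * (g0 * om2 d1 y - g1 * om2 d0 y) = om1 d0 y * (hh (phi y) * omdet y).
    by congr (_ * _); rewrite /omdet; lra.
  have T2 : om2 d0 y * (g1 * om1 d0 y - g0 * om1 d1 y) = om2 d0 y * (kk (phi y) * omdet y).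
    by congr (_ * _); rewrite /omdet; lra.
  by move: T1 T2; rewrite /omdet => T1 T2; lra.
have E1 : g1 = hh (phi y) * om1 d1 y + kk (phi y) * om2 d1 y.
  apply: (mulfI D); move: S1 S2; rewrite /omdet /= => S1 S2.
  have T1 : om1 d1 y * (g0 * om2 d1 y - g1 * om2 d0 y) = om1 d1 y * (hh (phi y) * omdet y).
    by congr (_ * _); rewrite /omdet; lra.
  have T2 : om2 d1 y * (g1 * om1 d0 y - g0 * om1 d1 y) = om2 d1 y * (kk (phi y) * omdet y).
    by congr (_ * _); rewrite /omdet; lra.
  by move: T1 T2; rewrite /omdet => T1 T2; lra.
rewrite E0 E1; ring.
Qed.

(** As omega12 is [dot de1 e2] and the second derivatives of [e1] commute, its exterior derivative
    only involves products of de1 with de2. Their tangential parts vanish, since de1 has no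
    [e1]-component and de2 no [e2]-component; the normal parts are given by the shape operator. *)
Lemma gauss_chart y : U y ->
  dd d0 (fun z => hh (phi z) * om1 d1 z + kk (phi z) * om2 d1 z) y -
  dd d1 (fun z => hh (phi z) * om1 d0 z + kk (phi z) * om2 d0 z) y =
  - (ka (phi y) * kc (phi y)) * omdet y.
Proof.
move=> Uy; have oU := chart_open.
have dD1 x : differentiable (dd x (@e1 R M \o phi)) y.
  exact: smooth_differentiable (smooth_dd x smooth_e1) Uy.
have dE1 := smooth_differentiable smooth_e1 Uy.
have dE2 := smooth_differentiable smooth_e2 Uy.
have dE3 := smooth_differentiable smooth_e3 Uy.
have GE x x' : dd x' (fun z => hh (phi z) * om1 x z + kk (phi z) * om2 x z) y =
    dot (dd x' (dd x (@e1 R M \o phi)) y) (e2 (phi y)) +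
    dot (dd x (@e1 R M \o phi) y) (dd x' (@e2 R M \o phi) y).
  rewrite -(dd_val (is_dd_dot x' (dD1 x) dE2)).
  apply: dd_near; near=> z; rewrite /= connection_chart //.
  by near: z; exact: open_nbhs_nbhs.
rewrite !GE (dd_sym_row d0 d1 oU smooth_e1 Uy).
have [u1 u2 u3] := e_unit (phi y); have [q12 q13 q23] := e_ortho (phi y).
have G11 x : dot (e1 (phi y)) (dd x (@e1 R M \o phi) y) = 0.
  apply: (@dd_dot_unit _ _ _ (@e1 R M \o phi) 1) => // z /=.
  by case: (e_unit (phi z)).
have G22 x : dot (e2 (phi y)) (dd x (@e2 R M \o phi) y) = 0.
  apply: (@dd_dot_unit _ _ _ (@e2 R M \o phi) 1) => // z /=.
  by case: (e_unit (phi z)).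
have G13 x : dot (e3 (phi y)) (dd x (@e1 R M \o phi) y) = ka (phi y) * om1 x y.
  rewrite dotC (@dd_dot_const _ _ _ (@e1 R M \o phi) (@e3 R M \o phi) 0) //; last first.
    by move=> z /=; case: (e_ortho (phi z)).
  by rewrite weingarten // !dotDr dotNr !dotZr /= u1 q12; ring.
have G23 x : dot (e3 (phi y)) (dd x (@e2 R M \o phi) y) = kc (phi y) * om2 x y.
  rewrite dotC (@dd_dot_const _ _ _ (@e2 R M \o phi) (@e3 R M \o phi) 0) //; last first.
    by move=> z /=; case: (e_ortho (phi z)).
  rewrite weingarten // !dotDr dotNr !dotZr /= u2 [dot (e2 _) (e1 _)]dotC q12; ring.
rewrite (frame_parseval (e_unit (phi y)) (e_ortho (phi y)) (dd d1 (@e1 R M \o phi) y)).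
rewrite (frame_parseval (e_unit (phi y)) (e_ortho (phi y)) (dd d0 (@e1 R M \o phi) y)).
rewrite !G11 !G22 !G13 !G23 /omdet; ring.
Unshelve. all: by end_near. Qed.

End Chart.

Arguments omdet {R M} phi y.

(** * Linear algebra of the structure equations *)

Section Algebra.
Context {R : realFieldType}.

(** Reduces a linear consequence of two vanishing expressions to a [ring] or [field] goal once the
    multipliers [c] and [d] are supplied. *)
Lemma eq_of_combination (c d E F x y : R) :
  E = 0 -> F = 0 -> x - y = c * E + d * F -> x = y.
Proof. by move=> -> ->; rewrite !mulr0 addr0 => /eqP; rewrite subr_eq0 => /eqP. Qed.

(** The letters [a], [b], [p] stand for omega1, omega2, dpsi on the coordinate directions 0 and 1,
    and [a01] for the derivative along 0 of component 1. Put beta = omega12 - dpsi + B theta2. Since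
    theta1 /\ alpha1 = theta2 /\ alpha2 and theta1 /\ alpha2 = - theta2 /\ alpha1, the last two
    hypotheses read beta /\ alpha2 = 0 and alpha1 /\ beta = alpha1 /\ alpha2, whence beta = alpha2.
    The multipliers are, up to sign, the values of alpha1 and alpha2 in Cramer's rule. *)
Lemma angle_algebra (u v h k B a0 a1 b0 b1 p0 p1 u0 u1 v0 v1 a01 a10 b01 b10 : R) :
  (u ^+ 2 + v ^+ 2) * (a0 * b1 - a1 * b0) != 0 ->
  u0 = B * (u * a0 + v * b0) * u - v * p0 ->
  u1 = B * (u * a1 + v * b1) * u - v * p1 ->
  v0 = B * (u * a0 + v * b0) * v + u * p0 ->
  v1 = B * (u * a1 + v * b1) * v + u * p1 ->
  a01 - a10 = h * (a0 * b1 - a1 * b0) ->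
  b01 - b10 = k * (a0 * b1 - a1 * b0) ->
  u0 * a1 + u * a01 - (v0 * b1 + v * b01) -
    (u1 * a0 + u * a10 - (v1 * b0 + v * b10)) = 0 ->
  v0 * a1 + v * a01 + (u0 * b1 + u * b01) -
    (v1 * a0 + v * a10 + (u1 * b0 + u * b10)) =
    (u * a0 - v * b0) * (v * a1 + u * b1) - (u * a1 - v * b1) * (v * a0 + u * b0) ->
  p0 = h * a0 + k * b0 - (v * a0 + u * b0) + B * (- v * a0 + u * b0) /\
  p1 = h * a1 + k * b1 - (v * a1 + u * b1) + B * (- v * a1 + u * b1).
Proof.
move=> D -> -> -> -> /eqP; rewrite subr_eq => /eqP -> /eqP; rewrite subr_eq => /eqP ->.
move=> /eqP; rewrite -subr_eq0 => /eqP H1 /eqP; rewrite -subr_eq0 => /eqP H2.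
split; apply: (mulfI D).
- by apply: (eq_of_combination (c := - (u * a0 - v * b0))
    (d := - (v * a0 + u * b0)) H1 H2); ring.
- by apply: (eq_of_combination (c := - (u * a1 - v * b1))
    (d := - (v * a1 + u * b1)) H1 H2); ring.
Qed.

(** Here [m] and [n] are the components of dpsi on omega1 and omega2, the quotients by [A2] those on
    alpha1 and alpha2, and [s], [c] the sine and cosine of twice the angle. Combining the two
    equations with coefficients [u], [v] isolates [m]; with [-v], [u], it isolates [n]. *)
Lemma connection_algebra (u v h k B C A2 s c : R) :
  A2 = u ^+ 2 + v ^+ 2 -> A2 != 0 -> A2 * s = 2 * (u * v) -> A2 * c = u ^+ 2 - v ^+ 2 ->
  let m := h - v - B * v in let n := k - u + B * u in
  2 * ((m * u - n * v) / A2) = C * s ->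
  2 * ((m * v + n * u) / A2) + 1 = - C * c ->
  h = v * (2^-1 + (B + C / 2)) /\ k = u * (2^-1 - (B + C / 2)).
Proof.
move=> EA A0 Es Ec m n H1 H2.
have X1 : 2 * (m * u - n * v) = C * (2 * (u * v)).
  by rewrite -Es mulrCA -H1; field.
have X2 : 2 * (m * v + n * u) + A2 = - C * (u ^+ 2 - v ^+ 2).
  by rewrite -Ec mulrCA -H2; field.
split; apply: (mulfI A0).
- have := congr1 ( *%R u) X1; have := congr1 ( *%R v) X2.
  rewrite EA /m /n; lra.
- have := congr1 ( *%R v) X1; have := congr1 ( *%R u) X2.
  rewrite EA /m /n; lra.
Qed.

(** [q0] and [q1] are the components of dpsi. The last hypothesis, ddpsi = 0, determines dC /\
    theta2, and the one before it is dC /\ theta1 = 0. Multiplying them by values of theta1 and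
    theta2 recovers dC; the factor 2 clears the denominator of dpsi. *)
Lemma dC_algebra (u v h k B C a0 a1 b0 b1 q0 q1 u0 u1 v0 v1 a01 a10 b01 b10 C0 C1 : R) :
  (u ^+ 2 + v ^+ 2) * (a0 * b1 - a1 * b0) != 0 ->
  h = v * (2^-1 + (B + C / 2)) -> k = u * (2^-1 - (B + C / 2)) ->
  q0 = v * ((C - 1) / 2) * a0 - u * ((C + 1) / 2) * b0 ->
  q1 = v * ((C - 1) / 2) * a1 - u * ((C + 1) / 2) * b1 ->
  u0 = B * (u * a0 + v * b0) * u - v * q0 ->
  u1 = B * (u * a1 + v * b1) * u - v * q1 ->
  v0 = B * (u * a0 + v * b0) * v + u * q0 ->
  v1 = B * (u * a1 + v * b1) * v + u * q1 ->
  a01 - a10 = h * (a0 * b1 - a1 * b0) ->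
  b01 - b10 = k * (a0 * b1 - a1 * b0) ->
  C0 * (u * a1 + v * b1) = C1 * (u * a0 + v * b0) ->
  ((v0 * ((C - 1) / 2) + v * (C0 / 2)) * a1 + v * ((C - 1) / 2) * a01 -
   ((u0 * ((C + 1) / 2) + u * (C0 / 2)) * b1 + u * ((C + 1) / 2) * b01)) -
  ((v1 * ((C - 1) / 2) + v * (C1 / 2)) * a0 + v * ((C - 1) / 2) * a10 -
   ((u1 * ((C + 1) / 2) + u * (C1 / 2)) * b0 + u * ((C + 1) / 2) * b10)) = 0 ->
  C0 = (C ^+ 2 - 1) * (u * a0 + v * b0) /\ C1 = (C ^+ 2 - 1) * (u * a1 + v * b1).
Proof.
move=> D -> -> -> -> -> -> -> -> /eqP; rewrite subr_eq => /eqP -> /eqP.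
rewrite subr_eq => /eqP -> /eqP; rewrite -subr_eq0 => /eqP HC HS.
split; apply: (mulfI D).
- by apply: (eq_of_combination (c := - 2 * (u * a0 + v * b0))
    (d := - (- v * a0 + u * b0)) HS HC); field.
- by apply: (eq_of_combination (c := - 2 * (u * a1 + v * b1))
    (d := - (- v * a1 + u * b1)) HS HC); field.
Qed.

(** The same elimination, with [kap] standing for ac/A^2. The Gauss equation contains the
    combination dB + dC/2, so dC has to be known beforehand. *)
Lemma dB_algebra (u v h k B C a0 a1 b0 b1 q0 q1 u0 u1 v0 v1 a01 a10 b01 b10
    B0 B1 C0 C1 kap : R) :
  (u ^+ 2 + v ^+ 2) * (a0 * b1 - a1 * b0) != 0 ->
  h = v * (2^-1 + (B + C / 2)) -> k = u * (2^-1 - (B + C / 2)) ->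
  q0 = v * ((C - 1) / 2) * a0 - u * ((C + 1) / 2) * b0 ->
  q1 = v * ((C - 1) / 2) * a1 - u * ((C + 1) / 2) * b1 ->
  u0 = B * (u * a0 + v * b0) * u - v * q0 ->
  u1 = B * (u * a1 + v * b1) * u - v * q1 ->
  v0 = B * (u * a0 + v * b0) * v + u * q0 ->
  v1 = B * (u * a1 + v * b1) * v + u * q1 ->
  a01 - a10 = h * (a0 * b1 - a1 * b0) ->
  b01 - b10 = k * (a0 * b1 - a1 * b0) ->
  C0 = (C ^+ 2 - 1) * (u * a0 + v * b0) -> C1 = (C ^+ 2 - 1) * (u * a1 + v * b1) ->
  B0 * (u * a1 + v * b1) = B1 * (u * a0 + v * b0) ->
  ((v0 * (2^-1 + (B + C / 2)) + v * (B0 + C0 / 2)) * a1 + h * a01 +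
   ((u0 * (2^-1 - (B + C / 2)) - u * (B0 + C0 / 2)) * b1 + k * b01)) -
  ((v1 * (2^-1 + (B + C / 2)) + v * (B1 + C1 / 2)) * a0 + h * a10 +
   ((u1 * (2^-1 - (B + C / 2)) - u * (B1 + C1 / 2)) * b0 + k * b10)) =
  - (kap * (u ^+ 2 + v ^+ 2)) * (a0 * b1 - a1 * b0) ->
  B0 = (1 + B * C + kap) * (u * a0 + v * b0) /\
  B1 = (1 + B * C + kap) * (u * a1 + v * b1).
Proof.
move=> D -> -> -> -> -> -> -> -> /eqP; rewrite subr_eq => /eqP -> /eqP.
rewrite subr_eq => /eqP -> -> -> /eqP; rewrite -subr_eq0 => /eqP HB /eqP.
rewrite -subr_eq0 => /eqP HS.
split; apply: (mulfI D).
- by apply: (eq_of_combination (c := - (u * a0 + v * b0))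
    (d := - (- v * a0 + u * b0)) HS HB); field.
- by apply: (eq_of_combination (c := - (u * a1 + v * b1))
    (d := - (- v * a1 + u * b1)) HS HB); field.
Qed.

End Algebra.

Lemma angle_exists (R : realType) (x y : R) : x ^+ 2 + y ^+ 2 = 1 ->
  exists t, cos t = x /\ sin t = y.
Proof.
move=> xy; have x1 : -1 <= x <= 1.
  by have := sqr_ge0 y; move: xy => xy y2; apply/andP; split; nra.
have sx : sin (acos x) = `|y|.
  by rewrite sin_acos // -xy addrC addKr sqrtr_sqr.
have cx : cos (acos x) = x by apply: acosK; rewrite in_itv.
have [y0|y0] := leP 0 y.
  by exists (acos x); rewrite sx cx ger0_norm.
by exists (- acos x); rewrite cosN sinN sx cx ltr0_norm // opprK.
Qed.

(** In axes rotated by [t0] the vector (u, v) has coordinates (r, w) with r > 0, so its angle with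
    the new first axis is [atan (w / r)]. *)
Lemma polar_atan (R : realType) (u v c s t0 : R) :
  c ^+ 2 + s ^+ 2 = 1 -> cos t0 = c -> sin t0 = s -> 0 < c * u + s * v ->
  let t := t0 + atan ((c * v - s * u) / (c * u + s * v)) in
  u = Num.sqrt (u ^+ 2 + v ^+ 2) * cos t /\ v = Num.sqrt (u ^+ 2 + v ^+ 2) * sin t.
Proof.
move=> cs ct st r0 /=; set r := c * u + s * v in r0 *; set w := c * v - s * u.
have rn : r != 0 by rewrite gt_eqF.
have rw : r ^+ 2 + w ^+ 2 = u ^+ 2 + v ^+ 2.
  rewrite -[RHS]mul1r -cs /r /w; ring.
have sq : Num.sqrt (1 + (w / r) ^+ 2) = Num.sqrt (u ^+ 2 + v ^+ 2) / r.
  have -> : 1 + (w / r) ^+ 2 = (r ^+ 2 + w ^+ 2) * r^-1 ^+ 2 by field.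
  by rewrite sqrtrM ?addr_ge0 ?sqr_ge0 // sqrtr_sqr ger0_norm ?invr_ge0 ?ltW // rw.
have A0 : Num.sqrt (u ^+ 2 + v ^+ 2) != 0.
  by rewrite gt_eqF // sqrtr_gt0 -rw ltr_pwDl ?sqr_ge0 // exprn_gt0.
have ca : cos (atan (w / r)) = r / Num.sqrt (u ^+ 2 + v ^+ 2).
  by rewrite cos_atan sq invf_div.
have sa : sin (atan (w / r)) = w / Num.sqrt (u ^+ 2 + v ^+ 2).
  have := atanK (w / r); rewrite /tan ca => E.
  have -> : sin (atan (w / r)) = sin (atan (w / r)) / (r / Num.sqrt (u ^+ 2 + v ^+ 2)) *
     (r / Num.sqrt (u ^+ 2 + v ^+ 2)) by rewrite divfK // mulf_neq0 ?invr_neq0.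
  by rewrite E; field; rewrite A0 rn.
rewrite cosD sinD ct st ca sa; split.
- transitivity ((c ^+ 2 + s ^+ 2) * u); first by rewrite cs mul1r.
  by rewrite /r /w; field.
- transitivity ((c ^+ 2 + s ^+ 2) * v); first by rewrite cs mul1r.
  by rewrite /r /w; field.
Qed.

(** Serves to deduce the smoothness of log A from that of its differential B theta1. *)
Lemma smooth_of_dd (R : realType) (V W : normedModType R) (U : set V) (f : V -> W) :
  open U -> (forall y, U y -> differentiable f y) ->
  (forall v, exists2 g, smooth U g & forall y, U y -> dd v f y = g y) -> smooth U f.
Proof.
move=> oU df Df [|k]; first by move=> y Uy; exact/differentiable_continuous/df.
apply/CkS; split=> // v; have [g sg fg] := Df v.
by apply: (Ck_ext oU _ (sg k)) => y Uy; rewrite -fg // ddE.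
Qed.

Lemma open_positive (R : realType) (V : normedModType R) (U : set V) (f : V -> R) :
  open U -> smooth U f -> open (U `&` [set z | 0 < f z]).
Proof.
move=> oU sf; rewrite openE => z [Uz fz]; rewrite /interior.
apply: filterI; first exact: open_nbhs_nbhs.
exact: (cvgr_gt (f z) (smooth_continuous sf Uz) 0 fz).
Qed.

(** Symmetry of second derivatives, read as ddf = 0; the components of df may be replaced by
    formulas because these hold on the whole open set [U]. *)
Lemma closed_form (R : realType) (V : normedModType R) (U : set V) (f g0 g1 : V -> R)
    (v w y : V) : open U -> smooth U f -> U y ->
  (forall z, U z -> dd v f z = g0 z) -> (forall z, U z -> dd w f z = g1 z) ->
  dd v g1 y - dd w g0 y = 0.
Proof.
move=> oU sf Uy E0 E1.
have -> : dd v g1 y = dd v (dd w f) y.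
  by apply: dd_near; near=> z; rewrite E1 //; near: z; exact: open_nbhs_nbhs.
have -> : dd w g0 y = dd w (dd v f) y.
  by apply: dd_near; near=> z; rewrite E0 //; near: z; exact: open_nbhs_nbhs.
by rewrite (dd_sym v w oU sf Uy) subrr.
Unshelve. all: by end_near. Qed.

(** * The differentials of psi, A, B, C, H and J *)

Section ChartForms.
Context {R : realType} {M : framed_surface R}.
Context {U : set 'rV[R]_2} {phi : 'rV[R]_2 -> M}.
Hypothesis cU : chart (@pos R M) U phi.

Notation X := (@pos R M \o phi).
Notation om1 := (om1 phi).
Notation om2 := (om2 phi).

Let oU := chart_open cU.

Lemma chart_near_mem (W : set M) y : open W -> U y -> W (phi y) ->
  \near y, U y /\ W (phi y).
Proof.
move=> oW Uy Wy; apply: filterI; first exact: open_nbhs_nbhs.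
have [_ _ cphi _ _] := cU; apply: (cphi y Uy W).
exact: open_nbhs_nbhs.
Qed.

Lemma chart_open_preimage (W : set M) : open W -> open (U `&` phi @^-1` W).
Proof. by move=> oW; rewrite openE => z [Uz Wz]; exact: chart_near_mem. Qed.

Lemma has_diff_dd (V : normedModType R) (W : set M) (g : M -> V) L y :
  has_diff W g L -> U y -> W (phi y) ->
  differentiable (g \o phi) y /\ forall xi, dd xi (g \o phi) y = L (phi y) (dd xi X y).
Proof.
by move=> H Uy Wy; have [dg Dg] := H U phi cU y Uy Wy; split=> // xi; rewrite !ddE.
Qed.

Lemma smooth_ka : smooth U (@ka R M \o phi : _ -> R).
Proof. by case: (coef_smooth M) => H _ _; exact: (smooth_pull cU H). Qed.

Lemma smooth_kc : smooth U (@kc R M \o phi : _ -> R).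
Proof. by case: (coef_smooth M) => _ H _; exact: (smooth_pull cU H). Qed.

Lemma smooth_uu : smooth U (@uu R M \o phi : _ -> R).
Proof. by case: (coef_smooth M) => _ _ [_ _ H _]; exact: (smooth_pull cU H). Qed.

Lemma smooth_vv : smooth U (@vv R M \o phi : _ -> R).
Proof. by case: (coef_smooth M) => _ _ [_ _ _ H]; exact: (smooth_pull cU H). Qed.

Lemma dd_ka y xi : U y -> dd xi (@ka R M \o phi : _ -> R) y =
  (ka (phi y) - kc (phi y)) *
  ((uu (phi y) - kk (phi y)) * om1 xi y + hh (phi y) * om2 xi y).
Proof.
move=> Uy; have [_ H] := has_diff_dd (@codazzi_a R M) Uy I.
by apply: (etrans (H xi)); rewrite om1E om2E.
Qed.

Lemma dd_kc y xi : U y -> dd xi (@kc R M \o phi : _ -> R) y =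
  (ka (phi y) - kc (phi y)) *
  ((vv (phi y) - hh (phi y)) * om2 xi y + kk (phi y) * om1 xi y).
Proof.
move=> Uy; have [_ H] := has_diff_dd (@codazzi_c R M) Uy I.
by apply: (etrans (H xi)); rewrite om1E om2E.
Qed.

Lemma smooth_curvH : smooth U (@curvH R M \o phi : _ -> R).
Proof.
change (smooth U (fun z => (ka (phi z) + kc (phi z)) * 2^-1)).
apply: (smoothM oU); last exact: smooth_cst.
exact: (smoothD oU smooth_ka smooth_kc).
Qed.

Lemma smooth_curvJ : smooth U (@curvJ R M \o phi : _ -> R).
Proof.
change (smooth U (fun z => (ka (phi z) - kc (phi z)) * 2^-1)).
apply: (smoothM oU); last exact: smooth_cst.
exact: (smoothD oU smooth_ka (smoothN oU smooth_kc)).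
Qed.

Definition th1 (xi y : 'rV[R]_2) : R :=
  uu (phi y) * om1 xi y + vv (phi y) * om2 xi y.
Definition th2 (xi y : 'rV[R]_2) : R :=
  - vv (phi y) * om1 xi y + uu (phi y) * om2 xi y.

Lemma theta1_chart y xi : theta1 (phi y) (dd xi X y) = th1 xi y.
Proof. by rewrite /th1 om1E om2E. Qed.

Lemma theta2_chart y xi : theta2 (phi y) (dd xi X y) = th2 xi y.
Proof. by rewrite /th2 om1E om2E. Qed.

Lemma smooth_th1 xi : smooth U (th1 xi).
Proof.
apply: (smoothD oU); apply: (smoothM oU);
  [exact: smooth_uu|exact: smooth_om1|exact: smooth_vv|exact: smooth_om2].
Qed.

(** Adding the two Codazzi equations cancels [h] and [k] and leaves da + dc = 2 J theta1. *)
Lemma dd_curvH y xi : U y ->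
  dd xi (@curvH R M \o phi : _ -> R) y = curvJ (phi y) * th1 xi y.
Proof.
move=> Uy.
have Ha := smooth_is_dd xi smooth_ka Uy; have Hc := smooth_is_dd xi smooth_kc Uy.
apply: (etrans (dd_val (is_derive_mulf (is_derive_addf Ha Hc) (is_derive_cst (2^-1 : R) y xi)))).
by rewrite dd_ka // dd_kc // /curvJ /th1 /cst /=; field.
Qed.

End ChartForms.

Arguments th1 {R M} phi xi y.
Arguments th2 {R M} phi xi y.

(** Where u = v = 0 the differential dH = J theta1 vanishes, which the absence of critical points of
    H forbids. *)
Lemma ampA_gt0 (R : realType) (M : framed_surface R) (p : M) : 0 < ampA p.
Proof.
rewrite /ampA sqrtr_gt0 lt_neqAle addr_ge0 ?sqr_ge0 // andbT eq_sym.
rewrite paddr_eq0 ?sqr_ge0 // !sqrf_eq0; apply/negP => /andP[/eqP u0 /eqP v0].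
apply: (@no_critical R M p) => U phi cU y Uy yp xi; rewrite -ddE.
apply: (etrans (dd_curvH cU xi Uy)).
by rewrite /th1 yp u0 v0 !mul0r addr0 mulr0.
Qed.

Lemma ampA_sqr (R : realType) (M : framed_surface R) (p : M) :
  ampA p ^+ 2 = uu p ^+ 2 + vv p ^+ 2.
Proof. by rewrite sqr_sqrtr // addr_ge0 ?sqr_ge0. Qed.

Lemma uv_neq0 (R : realType) (M : framed_surface R) (p : M) :
  uu p ^+ 2 + vv p ^+ 2 != 0.
Proof. by rewrite -ampA_sqr expf_neq0 // gt_eqF // ampA_gt0. Qed.

(** Near [p] the vector (u, v) stays in the open half plane around its direction at [p]; there the
    angle is a constant [t0] plus an arctangent, hence smooth. *)
Lemma local_angle_exists (R : realType) (M : framed_surface R) (p : M) :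
  exists W (psi : M -> R), local_angle W psi /\ W p.
Proof.
have A0 := ampA_gt0 p; pose c := uu p / ampA p; pose s := vv p / ampA p.
have cs : c ^+ 2 + s ^+ 2 = 1.
  by rewrite /c /s !expr_div_n -mulrDl -ampA_sqr divff // expf_neq0 // gt_eqF.
have [t0 [ct st]] := angle_exists cs.
pose r (q : M) := c * uu q + s * vv q.
have sr U phi : chart (@pos R M) U phi -> smooth U (r \o phi : _ -> R).
  move=> cU; have oU := chart_open cU.
  by apply: (smoothD oU); apply: (smoothM oU) => //; try exact: smooth_cst;
    [exact: smooth_uu|exact: smooth_vv].
(* Openness is checked in charts: [r] is smooth in each of them, and a chart carries open sets to
   open sets. *)
have oW : open [set q : M | 0 < r q].
  rewrite openE => q rq; have [U [phi [cU [y Uy yq]]]] := surface_charts q.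
  have oV := open_positive (chart_open cU) (sr U phi cU).
  have [_ _ _ oim _] := cU.
  have oI := oim _ (@subIsetl _ _ _) oV.
  apply: (filterS _ (open_nbhs_nbhs (conj oI _))) => [_ [z [_ rz] <-] //|].
  by exists y => //; split => //=; rewrite /= yq.
exists [set q | 0 < r q], (fun q => t0 + atan ((c * vv q - s * uu q) / r q)).
split; last first.
  rewrite /= /r /c /s; have -> : uu p / ampA p * uu p + vv p / ampA p * vv p = ampA p.
    transitivity (ampA p ^+ 2 / ampA p); first by rewrite ampA_sqr; field; rewrite gt_eqF.
    by field; rewrite gt_eqF.
  exact: A0.
split=> // [U phi cU|q /= rq].
  have oV := chart_open_preimage cU oW.
  have sub (W : normedModType R) (f : _ -> W) : smooth U f -> smooth (U `&` phi @^-1` [set q | 0 < r q]) f.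
    by apply: smooth_sub; exact: subIsetl.
  apply: (smoothD oV); first exact: smooth_cst.
  apply: (smooth_atan oV); apply: (smoothM oV).
    apply: (smoothD oV); first by apply: (smoothM oV);
      [exact: smooth_cst|exact: (sub _ _ (smooth_vv cU))].
    by apply: (smoothN oV); apply: (smoothM oV);
      [exact: smooth_cst|exact: (sub _ _ (smooth_uu cU))].
  apply: (smoothV oV) => [z [_ rz]|]; first by rewrite gt_eqF.
  exact: (sub _ _ (sr U phi cU)).
exact: (polar_atan cs ct st rq).
Qed.

Lemma is_dd_scalar (R : realType) (V : normedModType R) (p : R -> R) a (f : V -> R) y v :
  is_derive (f y) 1 p a -> differentiable f y ->
  is_derive y v (fun z => p (f z)) (a * dd v f y).
Proof.
move=> dp df; have [H1 H2] := derive_scalar_comp dp df.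
by rewrite ddE -H2; apply/derivableP/diff_derivable.
Qed.

Section Differentials.
Context {R : realType} {M : framed_surface R} {B C : M -> R}.
Hypothesis dalpha1 : has_extd (@alpha1 R M) (fun _ _ _ => 0).
Hypothesis dalpha2 : has_extd (@alpha2 R M) (wedge (@alpha1 R M) (@alpha2 R M)).
Hypothesis dtheta1 : has_extd (@theta1 R M) (fun _ _ _ => 0).
Hypothesis hB : is_B B.
Hypothesis hC : is_C C.

Section InChart.
Context {U : set 'rV[R]_2} {phi : 'rV[R]_2 -> M}.
Hypothesis cU : chart (@pos R M) U phi.

Notation X := (@pos R M \o phi).
Notation d0 := (delta_mx 0 0 : 'rV[R]_2).
Notation d1 := (delta_mx 0 1 : 'rV[R]_2).
Notation om1 := (om1 phi).
Notation om2 := (om2 phi).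
Notation th1 := (th1 phi).
Notation th2 := (th2 phi).
Notation omdet := (@omdet R M phi).
Notation u := (@uu R M \o phi : 'rV[R]_2 -> R).
Notation v := (@vv R M \o phi : 'rV[R]_2 -> R).
Notation Bp := (B \o phi : 'rV[R]_2 -> R).
Notation Cp := (C \o phi : 'rV[R]_2 -> R).

Let oU := chart_open cU.

Lemma smooth_B : smooth U Bp.
Proof. by case: hB => H _; exact: (smooth_pull cU H). Qed.

Lemma smooth_C : smooth U Cp.
Proof. by case: hC => H _; exact: (smooth_pull cU H). Qed.

Lemma is_dd_u y xi : U y -> is_derive y xi (fun z => uu (phi z)) (dd xi u y).
Proof. exact: smooth_is_dd (smooth_uu cU). Qed.

Lemma is_dd_v y xi : U y -> is_derive y xi (fun z => vv (phi z)) (dd xi v y).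
Proof. exact: smooth_is_dd (smooth_vv cU). Qed.

Lemma is_dd_B y xi : U y -> is_derive y xi (fun z => B (phi z)) (dd xi Bp y).
Proof. exact: smooth_is_dd smooth_B. Qed.

Lemma is_dd_C y xi : U y -> is_derive y xi (fun z => C (phi z)) (dd xi Cp y).
Proof. exact: smooth_is_dd smooth_C. Qed.

Lemma is_dd_om1 y xi x : U y -> is_derive y xi (fun z => om1 x z) (dd xi (om1 x) y).
Proof. exact: smooth_is_dd (smooth_om1 cU x). Qed.

Lemma is_dd_om2 y xi x : U y -> is_derive y xi (fun z => om2 x z) (dd xi (om2 x) y).
Proof. exact: smooth_is_dd (smooth_om2 cU x). Qed.

Lemma is_dd_th1 y xi x : U y -> is_derive y xi (fun z => th1 x z) (dd xi (th1 x) y).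
Proof. exact: smooth_is_dd (smooth_th1 cU x). Qed.

Lemma dd_expand (W : normedModType R) (f : 'rV[R]_2 -> W) y xi : differentiable f y ->
  dd xi f y = xi 0 0 *: dd d0 f y + xi 0 1 *: dd d1 f y.
Proof. by move=> df; rewrite -dd_comb // -delta2_expand. Qed.

Lemma om1_expand y xi : U y -> om1 xi y = xi 0 0 * om1 d0 y + xi 0 1 * om1 d1 y.
Proof. by move=> Uy; rewrite -(om1_comb cU) // -delta2_expand. Qed.

Lemma om2_expand y xi : U y -> om2 xi y = xi 0 0 * om2 d0 y + xi 0 1 * om2 d1 y.
Proof. by move=> Uy; rewrite -(om2_comb cU) // -delta2_expand. Qed.

Lemma dd_lnA y : U y -> differentiable (fun z => ln (ampA (phi z))) y /\
  forall xi, dd xi (fun z => ln (ampA (phi z))) y = B (phi y) * th1 xi y.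
Proof.
move=> Uy; have [H1 H2] := has_diff_dd cU (hB.2) Uy I.
by split=> [|xi]; [exact: H1|apply: (etrans (H2 xi)); rewrite theta1_chart].
Qed.

Lemma dd_ampA y : U y -> differentiable (@ampA R M \o phi : _ -> R) y /\
  forall xi, dd xi (@ampA R M \o phi : _ -> R) y =
    ampA (phi y) * B (phi y) * th1 xi y.
Proof.
move=> Uy; have [H1 H2] := dd_lnA Uy.
have -> : (@ampA R M \o phi : _ -> R) = (fun z => expR (ln (ampA (phi z)))).
  by apply/funext => z; rewrite lnK // posrE ampA_gt0.
have [H3 _] := @derive_scalar_comp _ _ expR _ (fun z => ln (ampA (phi z))) y
  (is_derive_expR _) H1.
split=> // xi; apply: (etrans (dd_val (@is_dd_scalar _ _ expR _
  (fun z => ln (ampA (phi z))) y xi (is_derive_expR _) H1))).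
by rewrite H2 lnK ?posrE ?ampA_gt0 // mulrA.
Qed.

Lemma smooth_lnA : smooth U (fun z => ln (ampA (phi z))).
Proof.
apply: smooth_of_dd => // [y Uy|xi]; first exact: (dd_lnA Uy).1.
exists (fun z => B (phi z) * th1 xi z); last by move=> y Uy; exact: (dd_lnA Uy).2.
by apply: (smoothM oU); [exact: smooth_B|exact: smooth_th1].
Qed.

Lemma dtheta1_chart y : U y -> dd d0 (th1 d1) y = dd d1 (th1 d0) y.
Proof.
move=> Uy; apply/eqP; rewrite -subr_eq0; apply/eqP.
by apply: (has_extd_dd cU dtheta1 Uy) => z; rewrite theta1_chart.
Qed.

(** For df = G theta1 with theta1 closed, ddf = 0 reduces to dG /\ theta1 = 0. *)
Lemma closed_multiple (f G : 'rV[R]_2 -> R) y : smooth U f -> smooth U G -> U y ->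
  (forall z xi, U z -> dd xi f z = G z * th1 xi z) ->
  dd d0 G y * th1 d1 y = dd d1 G y * th1 d0 y.
Proof.
move=> sf sG Uy fG.
have HG xi := smooth_is_dd xi sG Uy.
have := closed_form oU sf Uy (fun z => fG z d0) (fun z => fG z d1).
rewrite (dd_val (is_derive_mulf (HG d0) (is_dd_th1 d0 d1 Uy))).
rewrite (dd_val (is_derive_mulf (HG d1) (is_dd_th1 d1 d0 Uy))).
by rewrite dtheta1_chart // => E; lra.
Qed.

Lemma dB_theta1 y : U y -> dd d0 Bp y * th1 d1 y = dd d1 Bp y * th1 d0 y.
Proof.
move=> Uy; apply: (closed_multiple smooth_lnA smooth_B Uy) => z xi Uz.
exact: (dd_lnA Uz).2.
Qed.

Section Angle.
Context {W : set M} {psi : M -> R}.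
Hypothesis hpsi : local_angle W psi.

Notation ps := (psi \o phi : 'rV[R]_2 -> R).

Lemma smooth_psi : smooth (U `&` phi @^-1` W) ps.
Proof. by case: hpsi => _ H _; exact: H. Qed.

Lemma differentiable_psi y : U y -> W (phi y) -> differentiable ps y.
Proof. by move=> Uy Wy; exact: (smooth_differentiable smooth_psi). Qed.

Lemma dd_uv y xi : U y -> W (phi y) ->
  dd xi u y = B (phi y) * th1 xi y * uu (phi y) - vv (phi y) * dd xi ps y /\
  dd xi v y = B (phi y) * th1 xi y * vv (phi y) + uu (phi y) * dd xi ps y.
Proof.
move=> Uy Wy; have [oW _ uvE] := hpsi.
have near := chart_near_mem cU oW Uy Wy.
have dp := differentiable_psi Uy Wy; have [dA DA] := dd_ampA Uy.
have HA := differentiable_is_dd xi dA.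
have Hc := is_dd_scalar xi (is_derive_cos (ps y)) dp.
have Hs := is_dd_scalar xi (is_derive_sin (ps y)) dp.
have [Eu Ev] := uvE _ Wy; split.
- have -> : dd xi u y = dd xi (fun z => ampA (phi z) * cos (psi (phi z))) y.
    by apply: dd_near; apply: filterS near => z [_ /uvE[]].
  apply: (etrans (dd_val (is_derive_mulf HA Hc))); rewrite DA /= [in RHS]Eu [in RHS]Ev.
  ring.
- have -> : dd xi v y = dd xi (fun z => ampA (phi z) * sin (psi (phi z))) y.
    by apply: dd_near; apply: filterS near => z [_ /uvE[]].
  apply: (etrans (dd_val (is_derive_mulf HA Hs))); rewrite DA /= [in RHS]Eu [in RHS]Ev.
  ring.
Qed.

Lemma dd_psi_connection y xi : U y -> W (phi y) ->
  dd xi ps y = hh (phi y) * om1 xi y + kk (phi y) * om2 xi y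
    - (vv (phi y) * om1 xi y + uu (phi y) * om2 xi y) + B (phi y) * th2 xi y.
Proof.
move=> Uy Wy.
have [u0 v0] := dd_uv d0 Uy Wy; have [u1 v1] := dd_uv d1 Uy Wy.
have D : (uu (phi y) ^+ 2 + vv (phi y) ^+ 2) * omdet y != 0.
  by rewrite mulf_neq0 ?uv_neq0 // (omdet_neq0 cU).
have S1 := structure1_chart cU Uy; have S2 := structure2_chart cU Uy.
have H1 := has_extd_dd cU dalpha1 Uy
  (c0 := fun z => uu (phi z) * om1 d0 z - vv (phi z) * om2 d0 z)
  (c1 := fun z => uu (phi z) * om1 d1 z - vv (phi z) * om2 d1 z).
have H2 := has_extd_dd cU dalpha2 Uy
  (c0 := fun z => vv (phi z) * om1 d0 z + uu (phi z) * om2 d0 z)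
  (c1 := fun z => vv (phi z) * om1 d1 z + uu (phi z) * om2 d1 z).
have DM1 x x' : dd x' (fun z => uu (phi z) * om1 x z - vv (phi z) * om2 x z) y =
    dd x' u y * om1 x y + uu (phi y) * dd x' (om1 x) y -
    (dd x' v y * om2 x y + vv (phi y) * dd x' (om2 x) y).
  exact: (dd_val (is_derive_addf
    (is_derive_mulf (is_dd_u x' Uy) (is_dd_om1 x' x Uy))
    (is_derive_oppf (is_derive_mulf (is_dd_v x' Uy) (is_dd_om2 x' x Uy))))).
have DM2 x x' : dd x' (fun z => vv (phi z) * om1 x z + uu (phi z) * om2 x z) y =
    dd x' v y * om1 x y + vv (phi y) * dd x' (om1 x) y +
    (dd x' u y * om2 x y + uu (phi y) * dd x' (om2 x) y).
  exact: (dd_val (is_derive_addf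
    (is_derive_mulf (is_dd_v x' Uy) (is_dd_om1 x' x Uy))
    (is_derive_mulf (is_dd_u x' Uy) (is_dd_om2 x' x Uy)))).
rewrite !DM1 in H1; rewrite !DM2 in H2.
have {}H1 := H1 (fun z => ltac:(by rewrite om1E om2E)) (fun z => ltac:(by rewrite om1E om2E)).
have {}H2 := H2 (fun z => ltac:(by rewrite om1E om2E)) (fun z => ltac:(by rewrite om1E om2E)).
have E2 : wedge (@alpha1 R M) (@alpha2 R M) (phi y) (dd d0 X y) (dd d1 X y) =
    (uu (phi y) * om1 d0 y - vv (phi y) * om2 d0 y) *
    (vv (phi y) * om1 d1 y + uu (phi y) * om2 d1 y) -
    (uu (phi y) * om1 d1 y - vv (phi y) * om2 d1 y) *
    (vv (phi y) * om1 d0 y + uu (phi y) * om2 d0 y).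
  by rewrite !om1E !om2E.
have [P0 P1] := angle_algebra D u0 u1 v0 v1 S1 S2 H1 (etrans H2 E2).
rewrite dd_expand; last exact: differentiable_psi.
rewrite P0 P1 /th2 (om1_expand xi Uy) (om2_expand xi Uy) /GRing.scale /=; ring.
Qed.

End Angle.
End InChart.

(* Compares the coefficients of dpsi given by the structure equations with those
   in terms of which C is defined. *)
Lemma connection_coefficients (p : M) :
  hh p = vv p * (2^-1 + (B p + C p / 2)) /\ kk p = uu p * (2^-1 - (B p + C p / 2)).
Proof.
have [W [psi [hpsi Wp]]] := local_angle_exists p.
(* The components of dpsi on omega1 and omega2, by [dd_psi_connection]; [H] converts them to the
   coframe alpha1, alpha2 in which [is_C] is phrased, a change of basis of determinant A^2. *)
pose m q := hh q - vv q - B q * vv q; pose n q := kk q - uu q + B q * uu q.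
have H : has_diff W (psi : _ -> R^o) (fun q w =>
    ((m q * uu q - n q * vv q) / (uu q ^+ 2 + vv q ^+ 2)) * alpha1 q w +
    ((m q * vv q + n q * uu q) / (uu q ^+ 2 + vv q ^+ 2)) * alpha2 q w).
  move=> U phi cU y Uy Wy; split; first exact: (differentiable_psi cU hpsi Uy Wy).
  move=> xi; rewrite -!ddE; apply: (etrans (dd_psi_connection cU hpsi xi Uy Wy)).
  rewrite /alpha1 /alpha2 /omega1 /omega2 /th2 om1E om2E /m /n.
  by have := uv_neq0 (phi y) => A0; field.
have [E1 E2] := hC.2 W psi _ _ hpsi H p Wp.
have [_ _ /(_ p Wp) [Eu Ev]] := hpsi.
apply: (connection_algebra (erefl _) (uv_neq0 p) _ _ E1 E2).
- by rewrite -ampA_sqr [in RHS]Eu [in RHS]Ev [2 * psi p]mulr_natl mulr2n sinD; ring.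
- by rewrite -ampA_sqr [in RHS]Eu [in RHS]Ev [2 * psi p]mulr_natl mulr2n cosD; ring.
Qed.

(** * Coordinate components of dpsi, dJ, dC and dB *)

Section CoordinateDifferentials.
Context {U : set 'rV[R]_2} {phi : 'rV[R]_2 -> M}.
Hypothesis cU : chart (@pos R M) U phi.

Notation d0 := (delta_mx 0 0 : 'rV[R]_2).
Notation d1 := (delta_mx 0 1 : 'rV[R]_2).
Notation om1 := (om1 phi).
Notation om2 := (om2 phi).
Notation th1 := (th1 phi).
Notation omdet := (@omdet R M phi).
Notation u := (@uu R M \o phi : 'rV[R]_2 -> R).
Notation v := (@vv R M \o phi : 'rV[R]_2 -> R).
Notation Bp := (B \o phi : 'rV[R]_2 -> R).
Notation Cp := (C \o phi : 'rV[R]_2 -> R).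

Let oU := chart_open cU.

(** This is -(alpha2 + C theta2)/2 in the principal coframe; the right side does not depend on the
    branch. *)
Lemma dd_psi W (psi : M -> R) y xi : local_angle W psi -> U y -> W (phi y) ->
  dd xi (psi \o phi : _ -> R) y =
  vv (phi y) * ((C (phi y) - 1) / 2) * om1 xi y -
  uu (phi y) * ((C (phi y) + 1) / 2) * om2 xi y.
Proof.
move=> hpsi Uy Wy; rewrite (dd_psi_connection cU hpsi) //.
by have [-> ->] := connection_coefficients (phi y); rewrite /th2; field.
Qed.

(** The Codazzi equations give da - dc = 2 J ((u - 2k) omega1 + (2h - v) omega2), and the formulas
    for [h] and [k] turn the two coefficients into (2B + C) u and (2B + C) v. *)
Lemma dd_curvJ y xi : U y -> dd xi (@curvJ R M \o phi : _ -> R) y =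
  (2 * B (phi y) + C (phi y)) * curvJ (phi y) * th1 xi y.
Proof.
move=> Uy.
have Ha := smooth_is_dd xi (smooth_ka cU) Uy; have Hc := smooth_is_dd xi (smooth_kc cU) Uy.
apply: (etrans (dd_val (is_derive_mulf (is_derive_addf Ha (is_derive_oppf Hc))
  (is_derive_cst (2^-1 : R) y xi)))).
rewrite (dd_ka cU) // (dd_kc cU) // /curvJ /th1 /cst /=.
by have [-> ->] := connection_coefficients (phi y); field.
Qed.

Lemma curvJ_gt0 (p : M) : 0 < curvJ p.
Proof. by rewrite /curvJ divr_gt0 // subr_gt0 no_umbilic. Qed.

(** [closed_multiple] is applied to J itself, with G = (2B + C) J. In dG /\ theta1 the term with dJ
    drops out, dJ being a multiple of theta1; dividing by J > 0 leaves d(2B + C) /\ theta1 = 0, and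
    dB /\ theta1 = 0 is already known. *)
Lemma dC_theta1 y : U y -> dd d0 Cp y * th1 d1 y = dd d1 Cp y * th1 d0 y.
Proof.
move=> Uy.
pose G z := (2 * B (phi z) + C (phi z)) * curvJ (phi z).
have sG : smooth U G.
  apply: (smoothM oU); last exact: (smooth_curvJ cU).
  apply: (smoothD oU); last exact: (smooth_C cU).
  by apply: (smoothM oU); [exact: smooth_cst|exact: (smooth_B cU)].
have HJ xi := smooth_is_dd xi (smooth_curvJ cU) Uy.
have := closed_multiple cU (smooth_curvJ cU) sG Uy (fun z xi Uz => dd_curvJ xi Uz).
have DG xi : dd xi G y = (2 * dd xi Bp y + dd xi Cp y) * curvJ (phi y) +
    (2 * B (phi y) + C (phi y)) * ((2 * B (phi y) + C (phi y)) * curvJ (phi y) * th1 xi y).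
  rewrite -dd_curvJ //.
  apply: (etrans (dd_val (is_derive_mulf (is_derive_addf (is_derive_mulf
    (is_derive_cst (2 : R) y xi) (is_dd_B cU xi Uy)) (is_dd_C cU xi Uy)) (HJ xi)))).
  by rewrite /cst /=; ring.
rewrite !DG => E; have BB := dB_theta1 cU Uy; have J0 := curvJ_gt0 (phi y).
apply: (mulfI (lt0r_neq0 J0)).
have E' : 2 * (curvJ (phi y) * (dd d0 Bp y * th1 d1 y)) =
          2 * (curvJ (phi y) * (dd d1 Bp y * th1 d0 y)) by rewrite BB.
lra.
Qed.

(** A branch of the angle is used near the point and disappears from the result, which therefore
    holds on the whole chart. *)
Lemma dd_uv_coefficients y xi : U y ->
  dd xi u y = B (phi y) * th1 xi y * uu (phi y) - vv (phi y) *
    (vv (phi y) * ((C (phi y) - 1) / 2) * om1 xi y -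
     uu (phi y) * ((C (phi y) + 1) / 2) * om2 xi y) /\
  dd xi v y = B (phi y) * th1 xi y * vv (phi y) + uu (phi y) *
    (vv (phi y) * ((C (phi y) - 1) / 2) * om1 xi y -
     uu (phi y) * ((C (phi y) + 1) / 2) * om2 xi y).
Proof.
move=> Uy; have [W [psi [hpsi Wp]]] := local_angle_exists (phi y).
by have := dd_uv cU hpsi xi Uy Wp; rewrite (dd_psi xi hpsi Uy Wp).
Qed.

Lemma dd_C_coordinate y : U y ->
  dd d0 Cp y = (C (phi y) ^+ 2 - 1) * th1 d0 y /\
  dd d1 Cp y = (C (phi y) ^+ 2 - 1) * th1 d1 y.
Proof.
move=> Uy; have [W [psi [hpsi Wy]]] := local_angle_exists (phi y).
have [oW _ _] := hpsi; have oV := chart_open_preimage cU oW.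
have [u0 v0] := dd_uv_coefficients d0 Uy; have [u1 v1] := dd_uv_coefficients d1 Uy.
have D : (uu (phi y) ^+ 2 + vv (phi y) ^+ 2) * omdet y != 0.
  by rewrite mulf_neq0 ?uv_neq0 // (omdet_neq0 cU).
have S1 := structure1_chart cU Uy; have S2 := structure2_chart cU Uy.
have [Eh Ek] := connection_coefficients (phi y).
pose g x z := vv (phi z) * ((C (phi z) - 1) / 2) * om1 x z -
     uu (phi z) * ((C (phi z) + 1) / 2) * om2 x z.
(* [dd_psi] holds on the open set of points of the chart that land in the domain of the branch, so
   ddpsi = 0 can be used at [y]. *)
have := @closed_form _ _ _ _ (g d0) (g d1) d0 d1 y oV (smooth_psi cU hpsi) (conj Uy Wy)
  (fun z Vz => dd_psi d0 hpsi Vz.1 Vz.2) (fun z Vz => dd_psi d1 hpsi Vz.1 Vz.2).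
have HC x' s : is_derive y x' (fun z => (C (phi z) + s) / 2) (dd x' Cp y / 2).
  apply: is_derive_eq (is_derive_mulf (is_derive_addf (is_dd_C cU x' Uy)
    (is_derive_cst s y x')) (is_derive_cst (2^-1 : R) y x')) _.
  by rewrite /cst /=; ring.
have Dg x x' : dd x' (g x) y =
    (dd x' v y * ((C (phi y) - 1) / 2) + vv (phi y) * (dd x' Cp y / 2)) * om1 x y +
    vv (phi y) * ((C (phi y) - 1) / 2) * dd x' (om1 x) y -
    ((dd x' u y * ((C (phi y) + 1) / 2) + uu (phi y) * (dd x' Cp y / 2)) * om2 x y +
    uu (phi y) * ((C (phi y) + 1) / 2) * dd x' (om2 x) y).
  exact: (dd_val (is_derive_addf
   (is_derive_mulf (is_derive_mulf (is_dd_v cU x' Uy) (HC x' (-1))) (is_dd_om1 cU x' x Uy))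
   (is_derive_oppf
   (is_derive_mulf (is_derive_mulf (is_dd_u cU x' Uy) (HC x' 1)) (is_dd_om2 cU x' x Uy))))).
rewrite !Dg => HS.
exact: (dC_algebra D Eh Ek (erefl _) (erefl _) u0 u1 v0 v1 S1 S2 (dC_theta1 Uy) HS).
Qed.

Lemma dd_B_coordinate y : U y ->
  let kap := ka (phi y) * kc (phi y) / (uu (phi y) ^+ 2 + vv (phi y) ^+ 2) in
  dd d0 Bp y = (1 + B (phi y) * C (phi y) + kap) * th1 d0 y /\
  dd d1 Bp y = (1 + B (phi y) * C (phi y) + kap) * th1 d1 y.
Proof.
move=> Uy kap.
have [u0 v0] := dd_uv_coefficients d0 Uy; have [u1 v1] := dd_uv_coefficients d1 Uy.
have [C0 C1] := dd_C_coordinate Uy.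
have D : (uu (phi y) ^+ 2 + vv (phi y) ^+ 2) * omdet y != 0.
  by rewrite mulf_neq0 ?uv_neq0 // (omdet_neq0 cU).
have S1 := structure1_chart cU Uy; have S2 := structure2_chart cU Uy.
have [Eh Ek] := connection_coefficients (phi y).
have HG := gauss_chart cU Uy.
have KE : kap * (uu (phi y) ^+ 2 + vv (phi y) ^+ 2) = ka (phi y) * kc (phi y).
  by rewrite /kap divfK // uv_neq0.
rewrite -KE in HG.
pose g x z := vv (phi z) * (2^-1 + (B (phi z) + C (phi z) / 2)) * om1 x z +
     uu (phi z) * (2^-1 - (B (phi z) + C (phi z) / 2)) * om2 x z.
(* The formulas for [h] and [k] hold at every point, so they may be substituted under the
   derivative. *)
have gE x : (fun z => hh (phi z) * om1 x z + kk (phi z) * om2 x z) = g x.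
  by apply/funext => z; have [-> ->] := connection_coefficients (phi z).
have HS x' : is_derive y x' (fun z => B (phi z) + C (phi z) / 2)
    (dd x' Bp y + dd x' Cp y / 2).
  apply: is_derive_eq (is_derive_addf (is_dd_B cU x' Uy) (is_derive_mulf
    (is_dd_C cU x' Uy) (is_derive_cst (2^-1 : R) y x'))) _.
  by rewrite /cst /=; ring.
have Hp x' : is_derive y x' (fun z => 2^-1 + (B (phi z) + C (phi z) / 2))
    (dd x' Bp y + dd x' Cp y / 2).
  apply: is_derive_eq (is_derive_addf (is_derive_cst (2^-1 : R) y x') (HS x')) _.
  by rewrite add0r.
have Hm x' : is_derive y x' (fun z => 2^-1 - (B (phi z) + C (phi z) / 2))
    (- (dd x' Bp y + dd x' Cp y / 2)).
  apply: is_derive_eq (is_derive_addf (is_derive_cst (2^-1 : R) y x')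
    (is_derive_oppf (HS x'))) _.
  by rewrite add0r.
have Dg x x' : dd x' (g x) y =
    (dd x' v y * (2^-1 + (B (phi y) + C (phi y) / 2)) +
     vv (phi y) * (dd x' Bp y + dd x' Cp y / 2)) * om1 x y +
    hh (phi y) * dd x' (om1 x) y +
    ((dd x' u y * (2^-1 - (B (phi y) + C (phi y) / 2)) -
     uu (phi y) * (dd x' Bp y + dd x' Cp y / 2)) * om2 x y +
    kk (phi y) * dd x' (om2 x) y).
  rewrite Eh Ek -mulrN.
  exact: (dd_val (is_derive_addf
   (is_derive_mulf (is_derive_mulf (is_dd_v cU x' Uy) (Hp x')) (is_dd_om1 cU x' x Uy))
   (is_derive_mulf (is_derive_mulf (is_dd_u cU x' Uy) (Hm x')) (is_dd_om2 cU x' x Uy)))).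
rewrite !gE !Dg in HG.
exact: (dB_algebra D Eh Ek (erefl _) (erefl _) u0 u1 v0 v1 S1 S2 C0 C1 (dB_theta1 cU Uy) HG).
Qed.

End CoordinateDifferentials.

Lemma has_diff_theta1 (g : M -> R) (F : M -> R) :
  (forall U phi y, chart (@pos R M) U phi -> U y ->
    differentiable (g \o phi : _ -> R) y /\
    forall i : 'I_2, dd (delta_mx 0 i) (g \o phi : _ -> R) y =
      F (phi y) * th1 phi (delta_mx 0 i) y) ->
  has_diff setT (g : _ -> R^o) (fun p w => F p * theta1 p w).
Proof.
move=> H U phi cU y Uy _; have [dg Dg] := H U phi y cU Uy; split=> // xi.
rewrite -!ddE theta1_chart; apply: (etrans (dd_expand xi dg)).
rewrite !Dg /th1 (om1_expand cU xi Uy) (om2_expand cU xi Uy) /GRing.scale /=; ring.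
Qed.

Lemma ord2P (P : 'I_2 -> Prop) : P 0 -> P 1 -> forall i, P i.
Proof.
move=> P0 P1 [[|[|//]] hi].
- by rewrite (_ : Ordinal hi = 0) //; exact: val_inj.
- by rewrite (_ : Ordinal hi = 1) //; exact: val_inj.
Qed.

Lemma dH_theta1 : has_diff setT (@curvH R M : _ -> R^o) (fun p w => curvJ p * theta1 p w).
Proof.
apply: has_diff_theta1 => U phi y cU Uy.
by split=> [|i]; [exact: (smooth_differentiable (smooth_curvH cU))|exact: (dd_curvH cU _ Uy)].
Qed.

Lemma dJ_theta1 : has_diff setT (@curvJ R M : _ -> R^o)
  (fun p w => (2 * B p + C p) * curvJ p * theta1 p w).
Proof.
apply: has_diff_theta1 => U phi y cU Uy.
by split=> [|i]; [exact: (smooth_differentiable (smooth_curvJ cU))|exact: (dd_curvJ cU _ Uy)].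
Qed.

Lemma dA_theta1 : has_diff setT (@ampA R M : _ -> R^o)
  (fun p w => ampA p * B p * theta1 p w).
Proof.
apply: has_diff_theta1 => U phi y cU Uy.
by have [H1 H2] := dd_ampA cU Uy.
Qed.

Lemma dB_has_diff : has_diff setT (B : _ -> R^o)
  (fun p w => (1 + B p * C p + (curvH p ^+ 2 - curvJ p ^+ 2) / ampA p ^+ 2) * theta1 p w).
Proof.
apply: has_diff_theta1 => U phi y cU Uy.
split; first exact: (smooth_differentiable (smooth_B cU)).
have -> : (curvH (phi y) ^+ 2 - curvJ (phi y) ^+ 2) / ampA (phi y) ^+ 2 =
    ka (phi y) * kc (phi y) / (uu (phi y) ^+ 2 + vv (phi y) ^+ 2).
  by rewrite ampA_sqr /curvH /curvJ; have := uv_neq0 (phi y) => A0; field.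
by have [H0 H1] := dd_B_coordinate cU Uy; apply: ord2P.
Qed.

Lemma dC_has_diff : has_diff setT (C : _ -> R^o) (fun p w => (C p ^+ 2 - 1) * theta1 p w).
Proof.
apply: has_diff_theta1 => U phi y cU Uy.
split; first exact: (smooth_differentiable (smooth_C cU)).
by have [H0 H1] := dd_C_coordinate cU Uy; apply: ord2P.
Qed.

(** Again -(alpha2 + C theta2)/2, now rewritten with alpha2 = sin(2 psi) theta1 + cos(2 psi)
    theta2. *)
Lemma dpsi_has_diff W (psi : M -> R) : local_angle W psi ->
  has_diff W (psi : _ -> R^o) (fun p w =>
    - (sin (2 * psi p) / 2) * theta1 p w - ((C p + cos (2 * psi p)) / 2) * theta2 p w).
Proof.
move=> hpsi U phi cU y Uy Wy; split; first exact: (differentiable_psi cU hpsi Uy Wy).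
move=> xi; rewrite -!ddE theta1_chart theta2_chart.
apply: (etrans (dd_psi cU xi hpsi Uy Wy)).
have [_ _ /(_ _ Wy) [Eu Ev]] := hpsi.
have d2 x : 2 * x = x + x :> R by ring.
rewrite /th1 /th2 (d2 (psi _)) sinD cosD Eu Ev.
have cs := cos2Dsin2 (psi (phi y)); set c := cos _ in cs *; set s := sin _ in cs *.
set a := ampA _; set o1 := om1 _ _ _; set o2 := om2 _ _ _; set Cy := C _.
(* The two sides agree modulo cos^2 + sin^2 = 1; the multiplier is the coefficient of that relation
   in their difference. *)
apply: (eq_of_combination (c := - (a * s * o1 / 2 + a * c * o2 / 2)) (d := 0)
  (E := 1 - (c ^+ 2 + s ^+ 2)) (F := 0)) => //; first by rewrite cs subrr.
by field.
Qed.

End Differentials.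

Section RowSmooth.
Context {R : realType} {V : normedModType R}.

Lemma smooth_row (U : set V) n (f : V -> 'rV[R]_n) : open U ->
  (forall i, smooth U (fun y => f y 0 i)) -> smooth U f.
Proof. by move=> oU sf k; apply: Ck_row => // i; exact: sf. Qed.

Lemma smooth_entry (U : set V) n (f : V -> 'rV[R]_n) i : open U ->
  smooth U f -> smooth U (fun y => f y 0 i).
Proof. by move=> oU sf k; exact: Ck_entry. Qed.

Lemma differentiable_row n (f : V -> 'rV[R]_n) y :
  (forall i, differentiable (fun z => f z 0 i) y) -> differentiable f y.
Proof.
move=> df.
have -> : f = \sum_(j < n) (fun z => f z 0 j *: delta_mx 0 j).
  by apply/funext => z; rewrite fct_sumE; exact: row_sum_delta.
by apply: differentiable_sum => i; apply: differentiableZl.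
Qed.

End RowSmooth.

(** * Curves and isometries *)

Section Curves.
Context {R : realType}.

Lemma velocity_chart (M : surface R) U phi (g : R -> M) (V : set R^o)
    (b : R^o -> 'rV[R]_2) t : chart (@pos R M) U phi -> open V -> V t -> smooth V b ->
  (forall s, V s -> U (b s) /\ g s = phi (b s)) ->
  velocity g t = 'D_('D_1 b t) (@pos R M \o phi) (b t).
Proof.
move=> cU oV Vt sb gb; have [_ _ _ _ [sX _]] := cU.
have db := smooth_differentiable sb Vt.
have dX := smooth_differentiable sX (gb t Vt).1.
rewrite /velocity -(derive_comp db dX).2; apply: near_eq_derive.
by near=> s; rewrite /= (gb s _).2 //; near: s; exact: open_nbhs_nbhs.
Unshelve. all: by end_near. Qed.

Lemma constant_on_interval (I : set R) (F : R -> R) : is_interval I ->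
  (forall t, I t -> is_derive t 1 F 0) -> forall s t, I s -> I t -> F s = F t.
Proof.
move=> itvI dF.
suff H s t : s <= t -> I s -> I t -> F s = F t.
  by move=> s t Is It; have [st|/ltW ts] := leP s t; [exact: H|apply/esym/H].
move=> st Is It; have Ix x : x \in `[s, t] -> I x.
  by rewrite in_itv /= => xst; exact: itvI xst.
have cF : {within `[s, t], continuous F}.
  by apply: derivable_within_continuous => x xst; have [] := dF x (Ix x xst).
have [x xst|_ _] := @MVT_segment R F (fun=> 0) s t st _ cF.
  by apply: dF; apply: Ix; exact: subset_itv_oo_cc.
by rewrite mul0r => /eqP; rewrite subr_eq0 => /eqP.
Qed.

(** Along such a curve theta1 annihilates the velocity, so [f \o g] has zero derivative. *)
Lemma constant_along_theta2 (M : framed_surface R) (f F : M -> R) (I : set R) g :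
  has_diff setT (f : _ -> R^o) (fun p w => F p * theta1 p w) ->
  theta2_curve I g -> constant_along I g f.
Proof.
move=> df [oI itvI sg vg] s t Is It.
apply: (@constant_on_interval I (f \o g) itvI _ s t Is It) => {s t Is It} t It.
have [U [phi [V [b [cU oV Vt sb gb]]]]] := sg t It.
have [Ut gt] := gb t Vt; have [dfp Dfp] := df U phi cU (b t) Ut Logic.I.
have db := smooth_differentiable sb Vt.
have near : \near t, (f \o phi) (b t) = (f \o g) t.
  by apply: filterS (open_nbhs_nbhs (conj oV Vt)) => s /gb[_ /= ->].
apply: near_eq_is_derive near _.
have [dc Dc] := derive_comp db dfp.
have := @differentiable_is_dd _ _ _ ((f \o phi : _ -> R) \o b) t 1 dc.
rewrite ddE; congr is_derive; apply: (etrans (Dc 1)); rewrite Dfp.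
by rewrite -(velocity_chart cU oV Vt sb gb) -gt (vg t It).2 mulr0.
Qed.

End Curves.

Section DualFrame.
Context {R : realType} {N : framed_surface R}.

(** The tangent fields dual to the coordinate fields, found by inverting the coframe matrix with
    Cramer's rule; they form the smooth left inverse that [smooth_lift] asks for. *)
Lemma dual_frame_exists U phi : chart (@pos R N) U phi ->
  exists l : 'I_2 -> 'rV[R]_2 -> 'rV[R]_3, (forall i, smooth U (l i)) /\
    forall y, U y -> forall xi i, dot (l i y) ('D_xi (@pos R N \o phi) y) = xi 0 i.
Proof.
move=> cU; have oU := chart_open cU.
pose a x y := om1 phi x y; pose b x y := om2 phi x y.
pose l0 y := (omdet phi y)^-1 *: (b (delta_mx 0 1) y *: e1 (phi y)
  - a (delta_mx 0 1) y *: e2 (phi y)).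
pose l1 y := (omdet phi y)^-1 *: (a (delta_mx 0 0) y *: e2 (phi y)
  - b (delta_mx 0 0) y *: e1 (phi y)).
have sa x : smooth U (a x) by exact: smooth_om1.
have sb x : smooth U (b x) by exact: smooth_om2.
have sV : smooth U (fun y => (omdet phi y)^-1).
  apply: (smoothV oU) => [y Uy|]; first exact: (omdet_neq0 cU Uy).
  apply: (smoothD oU); first exact: (smoothM oU).
  by apply: (smoothN oU); exact: (smoothM oU).
have s1 j := smooth_entry j oU (smooth_e1 cU).
have s2 j := smooth_entry j oU (smooth_e2 cU).
have sl0 : smooth U l0.
  apply: (smooth_row oU) => j.
  have -> : (fun y => l0 y 0 j) = (fun y => (omdet phi y)^-1 *
    (b (delta_mx 0 1) y * e1 (phi y) 0 j - a (delta_mx 0 1) y * e2 (phi y) 0 j)).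
    by apply/funext => y; rewrite !mxE.
  apply: (smoothM oU) => //; apply: (smoothD oU); first exact: (smoothM oU).
  by apply: (smoothN oU); exact: (smoothM oU).
have sl1 : smooth U l1.
  apply: (smooth_row oU) => j.
  have -> : (fun y => l1 y 0 j) = (fun y => (omdet phi y)^-1 *
    (a (delta_mx 0 0) y * e2 (phi y) 0 j - b (delta_mx 0 0) y * e1 (phi y) 0 j)).
    by apply/funext => y; rewrite !mxE.
  apply: (smoothM oU) => //; apply: (smoothD oU); first exact: (smoothM oU).
  by apply: (smoothN oU); exact: (smoothM oU).
exists (fun i => if i == 0 then l0 else l1).
split; first by move=> i; case: ifP.
move=> y Uy xi; have D := omdet_neq0 cU Uy.
have E1 : dot (e1 (phi y)) ('D_xi (@pos R N \o phi) y) =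
    xi 0 0 * a (delta_mx 0 0) y + xi 0 1 * a (delta_mx 0 1) y.
  by rewrite -ddE -(om1_expand cU xi Uy) om1E.
have E2 : dot (e2 (phi y)) ('D_xi (@pos R N \o phi) y) =
    xi 0 0 * b (delta_mx 0 0) y + xi 0 1 * b (delta_mx 0 1) y.
  by rewrite -ddE -(om2_expand cU xi Uy) om2E.
have DE : omdet phi y = a (delta_mx 0 0) y * b (delta_mx 0 1) y -
  a (delta_mx 0 1) y * b (delta_mx 0 0) y by [].
apply: ord2P; rewrite /= /l0 /l1 dotZl dotDl dotNl !dotZl E1 E2; apply: (mulfI D);
  rewrite mulVKf // DE; ring.
Qed.

End DualFrame.

(* The transition map between [psi] and another chart is only continuous a
   priori; [smooth_lift] makes the lifted curve smooth. *)
Lemma curve_lift (R : realType) (N : framed_surface R) U psi (g : R -> N) (I : set R) t :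
  chart (@pos R N) U psi -> smooth_curve I g -> I t -> (psi @` U) (g t) ->
  exists (V : set R^o) (b : R^o -> 'rV[R]_2),
    [/\ open V, V t, smooth V b & forall s, V s -> U (b s) /\ g s = psi (b s)].
Proof.
move=> cU sg It Ogt; have [U' [phi [V [b [cU' oV Vt sb gb]]]]] := sg t It.
have [oU injpsi _ oimg _] := cU; have [oU' _ cphi _ [sX' _]] := cU'.
have cg s O : V s -> open O -> O (phi (b s)) -> \near s, O (phi (b s)).
  move=> Vs oO Os; have cb := smooth_continuous sb Vs; apply: (cb [set y | O (phi y)]).
  exact: (cphi _ (gb s Vs).1 O (open_nbhs_nbhs (conj oO Os))).
pose V2 : set R^o := V `&` [set s | (psi @` U) (phi (b s))].
have oO : open (psi @` U) by exact: oimg.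
have oV2 : open V2.
  rewrite openE => s [Vs Os]; rewrite /interior; apply: filterI.
    exact: open_nbhs_nbhs.
  exact: cg.
(* Coordinates of the curve in the chart [psi], by choice; 0 is a default value off [V2]. *)
have H s : {y | V2 s -> U y /\ psi y = phi (b s)}.
  apply: cid; have [[_ [y Uy yE]]|nV] := pselect (V2 s); first by exists y.
  by exists 0.
pose c s := sval (H s).
have cE s : V2 s -> U (c s) /\ psi (c s) = phi (b s) by exact: (svalP (H s)).
(* [psi] is injective on [U] and maps open subsets of [U] to open sets, so its inverse on the image
   is continuous. *)
have cc s : V2 s -> {for s, continuous c}.
  move=> Vs Z /= nZ; have [Us Es] := cE s Vs.
  have oZ : open (U `&` Z^°) by apply: openI => //; exact: open_interior.
  have oI := oimg _ (@subIsetl _ U Z^°) oZ.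
  have Is : (psi @` (U `&` Z^°)) (phi (b s)) by exists (c s).
  apply: filterS (filterI (cg s _ Vs.1 oI Is) (open_nbhs_nbhs (conj oV2 Vs))).
  move=> r [[z [Uz Zz] zE] Vr]; have [Ur Er] := cE r Vr.
  have cz : c r = z by apply: injpsi; rewrite ?inE // Er zE.
  by rewrite /preimage /= cz; exact: interior_subset.
have [l [sl lE]] := dual_frame_exists cU.
exists V2, c; split => //.
- by split => //=; rewrite -(gb t Vt).2.
- apply: (@smooth_lift _ _ _ _ V2 U (@pos R N \o psi) l c
    (@pos R N \o phi \o b)) => //.
  + exact: chart_smooth.
  + apply: (smooth_row oV2) => i k.
    apply: (@Ck_comp _ _ _ _ V2 U' (fun y => (@pos R N \o phi) y 0 i)) => //.
    * by move=> s [/gb[]].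
    * exact: smooth_entry.
    * by apply: Ck_sub (sb k) => s [].
  + by move=> s Vs; have [Us Es] := cE s Vs; split => //=; rewrite Es.
- by move=> s Vs; have [Us Es] := cE s Vs; split => //; rewrite (gb s Vs.1).2 Es.
Qed.

(** * Isometries preserving the mean curvature, and integral curves *)

Section Isometry.
Context {R : realType} {M N : framed_surface R} {f : M -> N}.
Hypothesis isof : is_isometry f.

(** A curve and its image have the same coordinate representation [b], in [phi] and in [f \o phi],
    so both forms are tested on the same direction ['D_1 b t]; the velocities are nonzero together
    because both charts are immersions. Conversely, a curve on [N] is first brought into a chart
    [f \o phi] by [curve_lift]. *)
Lemma maps_curves_of_kernel (w : form1 M) (w' : form1 N) :
  (forall U phi y xi, chart (@pos R M) U phi -> U y ->
    w' (f (phi y)) ('D_xi (@pos R N \o (f \o phi)) y) = 0 <->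
    w (phi y) ('D_xi (@pos R M \o phi) y) = 0) ->
  maps_curves_onto f w w'.
Proof.
move=> ww; have [[f' fK f'K] chf] := isof.
split=> [I g [oI itvI sg vg]|I g' [oI itvI sg' vg']].
- split=> // [t It|t It].
    have [U [phi [V [b [cU oV Vt sb gb]]]]] := sg t It.
    exists U, (f \o phi), V, b; split=> //; first by have [] := chf U phi cU.
    by move=> s /gb[Us /= ->].
  have [U [phi [V [b [cU oV Vt sb gb]]]]] := sg t It.
  have [cfU _] := chf U phi cU; have [Ut gt] := gb t Vt.
  have gfb s : V s -> U (b s) /\ (f \o g) s = (f \o phi) (b s).
    by move=> /gb[Us /= ->].
  have [v0 wv] := vg t It; move: v0 wv.
  rewrite (velocity_chart cU oV Vt sb gb) (velocity_chart cfU oV Vt sb gfb) /= gt.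
  move=> v0 wv; split; last exact/(ww U).
  have [_ _ _ _ [_ imm]] := cfU => /(imm _ Ut) x0; apply: v0.
  by rewrite x0; exact: derive0.
- have lift t : I t -> exists U phi (V : set R^o) (b : R^o -> 'rV[R]_2),
    [/\ chart (@pos R M) U phi, open V, V t, smooth V b &
        forall s, V s -> U (b s) /\ (f' \o g') s = phi (b s)].
    move=> It; have [U [phi [cU [y Uy yE]]]] := surface_charts (f' (g' t)).
    have [cfU _] := chf U phi cU.
    have Og : ((f \o phi) @` U) (g' t) by exists y => //=; rewrite yE f'K.
    have [V [b [oV Vt sb gb]]] := curve_lift cfU sg' It Og.
    exists U, phi, V, b; split=> // s /gb[Us E]; split=> //.
    by rewrite /= E /= fK.
  exists (f' \o g'); last by move=> t _ /=; rewrite f'K.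
  split=> // t It.
  have [U [phi [V [b [cU oV Vt sb gb]]]]] := lift t It.
  have [cfU _] := chf U phi cU; have [Ut gt] := gb t Vt.
  have gfb s : V s -> U (b s) /\ g' s = (f \o phi) (b s).
    by move=> /gb[Us /= <-]; rewrite f'K.
  have [v0 wv] := vg' t It; move: v0 wv.
  rewrite (velocity_chart cU oV Vt sb gb) (velocity_chart cfU oV Vt sb gfb) (gfb t Vt).2 gt.
  move=> v0 wv; split; last exact/(ww U).
  have [_ _ _ _ [_ imm]] := cU => /(imm _ Ut) x0; apply: v0.
  by rewrite x0; exact: derive0.
Qed.

Lemma dot_tangent (S : framed_surface R) U phi y xi eta :
  chart (@pos R S) U phi -> U y ->
  dot ('D_xi (@pos R S \o phi) y) ('D_eta (@pos R S \o phi) y) =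
  om1 phi xi y * om1 phi eta y + om2 phi xi y * om2 phi eta y.
Proof.
move=> cU Uy; rewrite -!ddE (tangent_expand cU xi Uy) (tangent_expand cU eta Uy).
have [u1 u2 u3] := e_unit (phi y); have [q12 q13 q23] := e_ortho (phi y).
rewrite dotDl !dotDr !dotZl !dotZr u1 u2 [dot (e2 _) (e1 _)]dotC q12; ring.
Qed.

Hypothesis Hf : forall p, curvH (f p) = curvH p.

Lemma isometry_theta1 U phi y xi : chart (@pos R M) U phi -> U y ->
  curvJ (f (phi y)) * th1 (f \o phi) xi y = curvJ (phi y) * th1 phi xi y.
Proof.
move=> cU Uy; have [_ chf] := isof; have [cfU _] := chf U phi cU.
rewrite -(dd_curvH cU xi Uy); apply: (etrans (esym (dd_curvH cfU xi Uy))).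
by congr dd; apply/funext => z /=; rewrite Hf.
Qed.

(** The direction [x0] represents theta2: its inner product with any [xi] is theta2 of [xi]. It lies
    in the kernel of theta1, hence in that of theta1 on [N] by [isometry_theta1]. As inner products
    are preserved, theta2 becomes on [N] the inner product with a vector orthogonal to (u', v'),
    that is, a multiple of theta2 on [N]. The principal frames themselves are not compared. *)
Lemma isometry_theta2 U phi y xi : chart (@pos R M) U phi -> U y ->
  th2 (f \o phi) xi y = 0 <-> th2 phi xi y = 0.
Proof.
move=> cU Uy; have [_ chf] := isof; have [cfU iso] := chf U phi cU.
have [x0 [a0 b0]] := om_surj cU (- vv (phi y)) (uu (phi y)) Uy.
have T0 : th1 (f \o phi) x0 y = 0.
  have := isometry_theta1 x0 cU Uy; rewrite /th1 a0 b0.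
  rewrite (_ : uu (phi y) * - vv (phi y) + vv (phi y) * uu (phi y) = 0) ?mulr0; last by ring.
  by move=> /eqP; rewrite mulf_eq0 gt_eqF ?curvJ_gt0 //= => /eqP.
have E eta : om1 (f \o phi) x0 y * om1 (f \o phi) eta y +
    om2 (f \o phi) x0 y * om2 (f \o phi) eta y = th2 phi eta y.
  rewrite -(dot_tangent _ _ cfU Uy) iso // (dot_tangent _ _ cU Uy) a0 b0.
  by rewrite /th2.
have E0 := E x0; rewrite [th2 phi x0 y]/th2 a0 b0 in E0; have E1 := E xi.
have A' := uv_neq0 (f (phi y)); have A := uv_neq0 (phi y).
move: T0 E0 E1; rewrite /th1 [th2 (f \o phi) xi y]/th2.
set u := uu (phi y) in A *; set v := vv (phi y) in A *.
set u' := uu _ in A' *; set v' := vv _ in A' *.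
change (uu ((f \o phi) y)) with u'; change (vv ((f \o phi) y)) with v'.
set a := om1 (f \o phi) x0 y; set b := om2 (f \o phi) x0 y.
set p := om1 (f \o phi) xi y; set q := om2 (f \o phi) xi y => T0 E0 <-.
pose mu := - v' * a + u' * b.
have K1 : (u' ^+ 2 + v' ^+ 2) * (a * p + b * q) = mu * (- v' * p + u' * q).
  by apply: (eq_of_combination (c := u' * p + v' * q) (d := 0) (F := 0) T0) => //;
    rewrite /mu; ring.
(* The squared length of [x0] is A^2 for both metrics, which shows that the multiplier does not
   vanish. *)
have K2 : mu ^+ 2 = (u' ^+ 2 + v' ^+ 2) * (u ^+ 2 + v ^+ 2).
  have -> : u ^+ 2 + v ^+ 2 = a * a + b * b by rewrite E0; ring.
  by apply: (eq_of_combination (c := - (u' * a + v' * b)) (d := 0) (F := 0) T0) => //;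
    rewrite /mu; ring.
have mu0 : mu != 0 by rewrite -sqrf_eq0 K2 mulf_neq0.
split=> Z.
- by apply: (mulfI A'); rewrite K1 Z !mulr0.
- by apply: (mulfI mu0); rewrite -K1 Z !mulr0.
Qed.

Lemma isometry_maps_curves :
  maps_curves_onto f (@theta2 R M) (@theta2 R N) /\
  maps_curves_onto f (@theta1 R M) (@theta1 R N).
Proof.
have [_ chf] := isof.
split; apply: maps_curves_of_kernel => U phi y xi cU Uy; have [cfU _] := chf U phi cU.
  rewrite -!ddE theta2_chart.
  have -> : theta2 (f (phi y)) (dd xi (@pos R N \o (f \o phi)) y) = th2 (f \o phi) xi y.
    exact: theta2_chart.
  exact: (isometry_theta2 xi cU Uy).
rewrite -!ddE theta1_chart.
have -> : theta1 (f (phi y)) (dd xi (@pos R N \o (f \o phi)) y) = th1 (f \o phi) xi y.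
  exact: theta1_chart.
have E := isometry_theta1 xi cU Uy; split=> Z.
- by apply: (mulfI (lt0r_neq0 (curvJ_gt0 (phi y)))); rewrite -E Z !mulr0.
- by apply: (mulfI (lt0r_neq0 (curvJ_gt0 (f (phi y))))); rewrite E Z !mulr0.
Qed.

End Isometry.

(** * The closed system *)

Section System.
Context {R : realType}.

Definition coord6 (k : nat) (s : 'rV[R]_6) : R := s 0 (inord k).

(** Coefficients of theta1 in the differentials of the six variables, in the order of [state];
    [systemQ] holds those of theta2, nonzero for psi at most. *)
Definition systemP (s : 'rV[R]_6) : 'rV[R]_6 := \row_(i < 6)
  [:: - (sin (2 * coord6 0 s) / 2);
      coord6 1 s * coord6 2 s;
      1 + coord6 2 s * coord6 3 s + (coord6 4 s ^+ 2 - coord6 5 s ^+ 2) / coord6 1 s ^+ 2;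
      coord6 3 s ^+ 2 - 1;
      coord6 5 s;
      (2 * coord6 2 s + coord6 3 s) * coord6 5 s]`_i.

Definition systemQ (s : 'rV[R]_6) : 'rV[R]_6 := \row_(i < 6)
  [:: - ((coord6 3 s + cos (2 * coord6 0 s)) / 2); 0; 0; 0; 0; 0]`_i.

Lemma smooth_coord6 (U : set 'rV[R]_6) k : open U -> smooth U (coord6 k).
Proof.
move=> oU; apply: (@smooth_entry _ _ U _ id (inord k) oU) => j.
by apply: (@Ck_lin _ _ _ j U idfun) => x; exact: cvg_id.
Qed.

Lemma open_admissible : open (@admissible R).
Proof.
have oT : open ([set: 'rV[R]_6] `&` [set s | 0 < coord6 1 s]).
  by apply: open_positive; [exact: openT|apply: smooth_coord6; exact: openT].
have := open_positive oT (smooth_coord6 5 oT).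
by congr open; apply/seteqP; split=> s /=; [move=> [[_ ?] ?]|move=> [? ?]; split].
Qed.

Lemma smooth_systemP : smooth (@admissible R) systemP.
Proof.
have oA := open_admissible; have sc k := smooth_coord6 k oA.
have sX (g : 'rV[R]_6 -> R) : smooth (@admissible R) g -> smooth (@admissible R) (fun s => g s ^+ 2).
  by move=> sg; under eq_fun do rewrite expr2; exact: smoothM.
have s2 (x : R) := @smooth_cst R 'rV[R]_6 R (@admissible R) x.
apply: (smooth_row oA) => i.
have -> : (fun s => systemP s 0 i) = (fun s =>
  [:: - (sin (2 * coord6 0 s) / 2);
      coord6 1 s * coord6 2 s;
      1 + coord6 2 s * coord6 3 s + (coord6 4 s ^+ 2 - coord6 5 s ^+ 2) / coord6 1 s ^+ 2;
      coord6 3 s ^+ 2 - 1;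
      coord6 5 s;
      (2 * coord6 2 s + coord6 3 s) * coord6 5 s]`_i).
  by apply/funext => s; rewrite mxE.
case: i => [[|[|[|[|[|[|//]]]]]] hi] /=.
- apply: (smoothN oA); apply: (smoothM oA) => //; apply: (smooth_sin oA).
  exact: (smoothM oA).
- exact: (smoothM oA).
- apply: (smoothD oA).
    by apply: (smoothD oA) => //; exact: (smoothM oA).
  apply: (smoothM oA).
    apply: (smoothD oA); first exact: sX.
    by apply: (smoothN oA); exact: sX.
  apply: (smoothV oA) => [s [s1 _]|]; last exact: sX.
  by rewrite expf_neq0 // gt_eqF.
- by apply: (smoothD oA) => //; exact: sX.
- exact: sc.
- apply: (smoothM oA) => //; apply: (smoothD oA) => //.
  exact: (smoothM oA).
Qed.

Lemma smooth_systemQ : smooth (@admissible R) systemQ.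
Proof.
have oA := open_admissible; have sc k := smooth_coord6 k oA.
have s2 (x : R) := @smooth_cst R 'rV[R]_6 R (@admissible R) x.
apply: (smooth_row oA) => i.
have -> : (fun s => systemQ s 0 i) = (fun s =>
  [:: - ((coord6 3 s + cos (2 * coord6 0 s)) / 2); 0; 0; 0; 0; 0]`_i).
  by apply/funext => s; rewrite mxE.
case: i => [[|[|[|[|[|[|//]]]]]] hi] /=; try exact: s2.
apply: (smoothN oA); apply: (smoothM oA) => //; apply: (smoothD oA) => //.
by apply: (smooth_cos oA); exact: (smoothM oA).
Qed.

Lemma coord6_state (M : framed_surface R) (psi B C : M -> R) (p : M) k : (k < 6)%N ->
  coord6 k (state psi B C p) = [:: psi p; ampA p; B p; C p; curvH p; curvJ p]`_k.
Proof. by move=> k6; rewrite /coord6 mxE inordK. Qed.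

End System.

Lemma has_diff_subset (R : realType) (M : framed_surface R) (V : normedModType R)
    (W W' : set M) (g : M -> V) L : W' `<=` W -> has_diff W g L -> has_diff W' g L.
Proof. by move=> sW H U phi cU y Uy Wy; exact: (H U phi cU y Uy (sW _ Wy)). Qed.

Lemma has_diff_row (R : realType) (M : framed_surface R) n (W : set M)
    (g : M -> 'rV[R]_n) (L : M -> 'rV[R]_3 -> 'rV[R]_n) :
  (forall i, has_diff W ((fun p => g p 0 i) : _ -> R^o) (fun p w => L p w 0 i)) ->
  has_diff W g L.
Proof.
move=> H U phi cU y Uy Wy.
have dg : differentiable (g \o phi) y.
  by apply: differentiable_row => i; have [] := H i U phi cU y Uy Wy.
split=> // xi; apply/rowP => i; have [_ Hi] := H i U phi cU y Uy Wy.
by rewrite -(derivable_row _ dg) -Hi.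
Qed.

Theorem proposition6p1 (R : realType) :
  exists P Q : 'rV[R]_6 -> 'rV[R]_6,
    smooth (@admissible R) P /\ smooth (@admissible R) Q /\
    forall (M : framed_surface R) (B C : M -> R)
      (dalpha1 : has_extd (@alpha1 R M) (fun _ _ _ => 0))
      (dalpha2 : has_extd (@alpha2 R M) (wedge (@alpha1 R M) (@alpha2 R M)))
      (dtheta1 : has_extd (@theta1 R M) (fun _ _ _ => 0))
      (hB : is_B B) (hC : is_C C),
      (forall (W : set M) (psi : M -> R), local_angle W psi ->
         has_diff W (state psi B C) (fun p w =>
           theta1 p w *: P (state psi B C p) +
           theta2 p w *: Q (state psi B C p))) /\
      (forall (I : set R) (g : R -> M), theta2_curve I g ->
         [/\ constant_along I g (@curvH R M),
             constant_along I g (@curvJ R M),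
             constant_along I g (@ampA R M),
             constant_along I g B &
             constant_along I g C]) /\
      (forall (N : framed_surface R) (f : M -> N),
         is_isometry f -> (forall p, curvH (f p) = curvH p) ->
         maps_curves_onto f (@theta2 R M) (@theta2 R N) /\
         maps_curves_onto f (@theta1 R M) (@theta1 R N)).
Proof.
exists systemP, systemQ; split; first exact: smooth_systemP.
split; first exact: smooth_systemQ.
move=> M B C dalpha1 dalpha2 dtheta1 hB hC.
have dB := dB_has_diff dalpha1 dalpha2 dtheta1 hB hC.
have dC := dC_has_diff dalpha1 dalpha2 dtheta1 hB hC.
have dJ := dJ_theta1 dalpha1 dalpha2 hB hC.
have dA := dA_theta1 hB.
have dH := @dH_theta1 R M.
split=> [W psi hpsi|].
  have dpsi := dpsi_has_diff dalpha1 dalpha2 hB hC hpsi.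
  (* The variables other than psi have no theta2-component. *)
  have sub g F : has_diff setT (g : M -> R^o) (fun p w => F p * theta1 p w) ->
      has_diff W (g : M -> R^o) (fun p w => theta1 p w * F p + theta2 p w * 0).
    move=> /(has_diff_subset (@subsetT _ W)); congr has_diff.
    by apply/funext => p; apply/funext => w; rewrite mulr0 addr0 mulrC.
  apply: has_diff_row => i.
  have -> : (fun p => state psi B C p 0 i) =
      (fun p => [:: psi p; ampA p; B p; C p; curvH p; curvJ p]`_i).
    by apply/funext => p; rewrite mxE.
  have -> : (fun p (w : 'rV[R]_3) => (theta1 p w *: systemP (state psi B C p) +
      theta2 p w *: systemQ (state psi B C p)) 0 i) =
    (fun p w => theta1 p w * [:: - (sin (2 * psi p) / 2); ampA p * B p;
      1 + B p * C p + (curvH p ^+ 2 - curvJ p ^+ 2) / ampA p ^+ 2;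
      C p ^+ 2 - 1; curvJ p; (2 * B p + C p) * curvJ p]`_i +
      theta2 p w * [:: - ((C p + cos (2 * psi p)) / 2); 0; 0; 0; 0; 0]`_i).
    by apply/funext => p; apply/funext => w; rewrite !mxE !coord6_state.
  case: i => [[|[|[|[|[|[|//]]]]]] hi] /=; try exact: sub.
  move: dpsi; congr has_diff; apply/funext => p; apply/funext => w; ring.
split=> [I g hg|N f isof Hf]; last exact: isometry_maps_curves.
by split; [exact: (constant_along_theta2 dH hg)|exact: (constant_along_theta2 dJ hg)
  |exact: (constant_along_theta2 dA hg)|exact: (constant_along_theta2 dB hg)
  |exact: (constant_along_theta2 dC hg)].
Qed.
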